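(* Let $k$ be an even integer with $k\le\dim X$ and let $\mathbf S$ be a $k$-maximal torus in $\mathbf H$. Then $\mathbf H^{\mathbf S}$ is nonempty and (Zariski) open in $\mathbf H_k$.
   Context: $F$ is a field of characteristic not two, $X$ is a finite-dimensional $F$-vector space with a nondegenerate symmetric or antisymmetric bilinear form, $H$ is its group of linear isometries. Bold letters denote $\overline F$-points. $\mathbf H_k=\{h\in\mathbf H\mid\mathrm{rank}(h-1;X)\le k\}$. A $k$-maximal torus is a torus $\mathbf S\subseteq\mathbf H_k$ of the greatest possible dimension, which is $k/2$ (defined over $F$). $\mathbf E=\mathbf X^{\mathbf S}$ is the space of vectors fixed by $\mathbf S$, $\mathbf E^\circ$ its orthogonal complement in $\mathbf X$, $\mathbf H^{\mathbf E}$ the subgroup of $\mathbf H$ fixing $\mathbf E$ pointwise ($\mathbf S$ is a maximal torus of $\mathbf H^{\mathbf E}$). $\mathbf S_r$ is the set of $\gamma\in\mathbf S$ such that $\alpha(\gamma)\ne1$ for all roots $\alpha\in R(\mathbf H^{\mathbf E},\mathbf S)$ and $(\gamma-1)|_{\mathbf E^\circ}$ is invertible. $\mathbf H^{\mathbf S}$ is the union of the $\mathbf H$-conjugates of $\mathbf S_r$. *)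

(* Defs.v *)
From mathcomp Require Import all_boot all_order all_algebra.
From mathcomp Require Import mpoly.

Set Implicit Arguments.
Unset Strict Implicit.
Unset Printing Implicit Defensive.

Import GRing.Theory.
Local Open Scope ring_scope.

(* Conventions.  K stands for the algebraic closure of F.  The space of       *)
(* K-points of X is 'cV[K]_n (coordinates in a basis of X), on which square   *)
(* matrices act on the left.  Subsets of 'M[K]_n are predicates into Prop.    *)

Section AffineSpaceOfMatrices.
Variables (K : closedFieldType) (n : nat).
Implicit Types (A s : 'M[K]_n) (S U Y Z : 'M[K]_n -> Prop).

Definition mxpt A : 'I_(n * n) -> K := fun i => mxvec A 0 i.

Definition zariski_closed Z :=
  exists P : {mpoly K[n * n]} -> Prop,
    forall A, Z A <-> forall p, P p -> p.@[mxpt A] = 0.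

Definition zariski_open_in Y U :=
  exists2 Z, zariski_closed Z & forall A, U A <-> Y A /\ ~ Z A.

Definition vanishing_ideal Z (p : {mpoly K[n * n]}) :=
  forall A, Z A -> p.@[mxpt A] = 0.

(* Regular functions on a closed subset of GL_n: the coordinate ring of GL_n  *)
(* is generated by the entries and the inverse of the determinant.            *)
Definition regular_on S (f : 'M[K]_n -> K) :=
  exists (p : {mpoly K[n * n]}) (m : nat),
    forall s, S s -> f s = p.@[mxpt s] / \det s ^+ m.

Definition closed_subgroup S :=
  [/\ S 1%:M,
      forall s t, S s -> S t -> S (s *m t),
      forall s, S s -> S (invmx s)
    & exists2 Z, zariski_closed Z & forall s, S s <-> s \in unitmx /\ Z s].

(* Tangent space at the identity, cut out by the differentials at 1 of all    *)
(* the polynomials vanishing on S.                                            *)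
Definition lie_algebra S (A : 'M[K]_n) :=
  forall p, vanishing_ideal S p ->
    \sum_(i < n * n) (p^`M(i)).@[mxpt 1%:M] * mxpt A i = 0.

(* Only the values of a character on S are meaningful.                        *)
Definition is_character S (alpha : 'M[K]_n -> K) :=
  [/\ regular_on S alpha,
      forall s, S s -> alpha s != 0
    & forall s t, S s -> S t -> alpha (s *m t) = alpha s * alpha t].

(* R(G, S): the nontrivial characters of S whose weight space in Lie(G),      *)
(* under the adjoint action, is nonzero.                                      *)
Definition is_root (G S : 'M[K]_n -> Prop) (alpha : 'M[K]_n -> K) :=
  [/\ is_character S alpha,
      exists2 s, S s & alpha s != 1
    & exists A, [/\ lie_algebra G A, A != 0
        & forall s, S s -> s *m A *m invmx s = alpha s *: A]].

End AffineSpaceOfMatrices.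

Section Tori.
Variable K : closedFieldType.

Definition alg_morphism n m (S : 'M[K]_n -> Prop) (T : 'M[K]_m -> Prop)
    (f : 'M[K]_n -> 'M[K]_m) :=
  [/\ forall s, S s -> T (f s),
      forall s t, S s -> S t -> f (s *m t) = f s *m f t
    & forall i j, regular_on S (fun s => f s i j)].

Definition alg_isomorphic n m (S : 'M[K]_n -> Prop) (T : 'M[K]_m -> Prop) :=
  exists (f : 'M[K]_n -> 'M[K]_m) (g : 'M[K]_m -> 'M[K]_n),
    [/\ alg_morphism S T f, alg_morphism T S g,
        forall s, S s -> g (f s) = s & forall t, T t -> f (g t) = t].

Definition diag_group d (t : 'M[K]_d) : Prop :=
  is_diag_mx t && (t \in unitmx).

Definition is_torus n (S : 'M[K]_n -> Prop) (d : nat) :=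
  closed_subgroup S /\ alg_isomorphic S (@diag_group d).

End Tori.

(* S is defined over F: its vanishing ideal is generated by polynomials with  *)
(* coefficients in F (no perfectness assumption on F is implied).             *)
Definition defined_over (F : fieldType) (K : closedFieldType)
    (iota : {rmorphism F -> K}) n (S : 'M[K]_n -> Prop) :=
  forall p, vanishing_ideal S p ->
    exists (r : nat) (q : 'I_r -> {mpoly F[n * n]})
           (c : 'I_r -> {mpoly K[n * n]}),
      (forall i, vanishing_ideal S (map_mpoly iota (q i))) /\
      p = \sum_(i < r) c i * map_mpoly iota (q i).

(* Below, B is the Gram matrix of the form, so that the form on 'cV[K]_n is   *)
(* (u, v) |-> u^T B v.                                                        *)
Section IsometryGroup.
Variables (K : closedFieldType) (n : nat) (B : 'M[K]_n).
Implicit Types (S : 'M[K]_n -> Prop) (h g : 'M[K]_n) (v w : 'cV[K]_n).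

Definition isometries h := h \in unitmx /\ h^T *m B *m h = B.

Definition isometries_le (k : nat) h :=
  isometries h /\ (\rank (h - 1%:M)%R <= k)%N.

Definition fixed_space S v := forall s, S s -> s *m v = v.

Definition orth (E : 'cV[K]_n -> Prop) v := forall w, E w -> w^T *m B *m v = 0.

Definition pointwise_fixer (E : 'cV[K]_n -> Prop) h :=
  isometries h /\ forall v, E v -> h *m v = v.

Definition invertible_on (V : 'cV[K]_n -> Prop) (a : 'M[K]_n) :=
  (forall v, V v -> V (a *m v)) /\
  (forall v, V v -> exists! w, V w /\ a *m w = v).

Definition regular_part S g :=
  [/\ S g,
      forall alpha, is_root (pointwise_fixer (fixed_space S)) S alpha ->
        alpha g != 1
    & invertible_on (orth (fixed_space S)) (g - 1%:M)].

Definition conjugates_of_regular_part S h :=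
  exists x g, [/\ isometries x, regular_part S g & h = x *m g *m invmx x].

End IsometryGroup.

(* The greatest dimension is taken over all tori contained in H_k over the    *)
(* algebraic closure; S itself is moreover required to be defined over F.     *)
Definition maximal_torus_le (F : fieldType) (K : closedFieldType)
    (iota : {rmorphism F -> K}) n (B : 'M[K]_n) (k : nat)
    (S : 'M[K]_n -> Prop) :=
  defined_over iota S /\
  exists d, [/\ is_torus S d,
      forall s, S s -> isometries_le B k s
    & forall (S' : 'M[K]_n -> Prop) (d' : nat), is_torus S' d' ->
        (forall s, S' s -> isometries_le B k s) -> (d' <= d)%N].

(* Gram matrix, over K, of a form on X in a basis e of X.                     *)
Definition gram_over (F : fieldType) (K : closedFieldType)
    (iota : {rmorphism F -> K}) (X : vectType F) n (e : n.-tuple X)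
    (b : X -> X -> F) : 'M[K]_n :=
  \matrix_(i < n, j < n) iota (b e`_i e`_j).

(* Main.v *)
Require Import Defs.
From mathcomp Require Import all_boot all_order all_algebra.
From mathcomp Require Import mpoly.
From mathcomp Require Import ring zify.
From Stdlib Require Import Classical FunctionalExtensionality PropExtensionality.

(** Write k = 2m, let B be the Gram matrix over the algebraic closure K, and
    call a family of columns U = (u_i), W = (w_i), i < m, hyperbolic when the
    u_i are isotropic and mutually orthogonal, so are the w_i, and
    B(u_i, w_j) = 1 or 0 according as i = j or not.  Such a family spans a
    space of dimension k and carries the torus of all the maps that multiply
    u_i by t_i, w_i by t_i^-1 and fix the orthogonal complement of the family.

    Every k-maximal torus S is one of these standard tori
    ([maximal_torus_standard]).  A torus with d parameters decomposes
    the space into weight spaces, because a matrix of Laurent polynomials that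
    is multiplicative has, by the linear independence of characters, components
    on which the torus acts through a character; weight spaces of weights a and
    b are orthogonal unless a + b = 0.  The torus acts faithfully, so its weights
    span Q^d; d independent weights together with their opposites give a
    hyperbolic family of size d.  The rank condition yields d <= m, while the
    standard tori, which do lie in H_k, force d >= m by maximality.  Hence
    d = m, and an isometry h such that h - 1 has rank at most k and that has
    prescribed eigenvalues, all different from 1, on the family is determined
    ([frame_map_recognize]); the other points of S are quotients of such ones.

    The regular part is then explicit ([regular_partP]): the roots of S are the
    products of the weights of two vectors a, b of the family that span an
    isotropic plane (or coincide, in the symplectic case), with root vector
    a b^T B -+ b a^T B.  So S_r is given by t_i <> 1, t_i <> t_j, t_i t_j <> 1
    for i <> j and, in the symplectic case, t_i^2 <> 1.  An orthogonal S_r thus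
    contains elements having -1 as a double eigenvalue, and this rules out an
    equation for its complement based on the discriminant of the characteristic
    polynomial of h.

    By Witt's theorem, H^S is the set of all the elements with regular
    parameters of all the standard tori ([conjugatesP]).  Openness is proved
    around each of its points h0.  For an isometry h put N = h + h^-1 - 2; its
    eigenvalues are t + t^-1 - 2, so each should occur twice on the moving part.
    The neighbourhood of h0 is defined by two conditions on h in H_k:
    some minor of h - 1 of size k that is nonzero at h0 is nonzero, so that
    h - 1 has rank exactly k; and the determinant of the matrix of traces of
    N^(i+j+1) psi(N), i, j < m, is nonzero, where psi is 1 in the orthogonal case
    and N + 4 in the symplectic case.  On a regular element this determinant is
    2^m times the square of a Vandermonde determinant times a nonzero product
    ([hankel_split]).  Conversely, if it does not vanish then N has at least m
    distinct eigenvalues that are not 0, nor -4 in the symplectic case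
    ([hankel_eigenvalues]).  Each of their eigenspaces has dimension at least 2:
    t and t^-1 are eigenvalues of h together, and -1 has even multiplicity in
    the orthogonal case since h - h^-1 is skew for the form and skew matrices
    have even rank ([eigenspaceN1_even]).  As they lie in the image of h - 1,
    of dimension 2m, they are planes that fill it, they are nondegenerate, and
    each has a hyperbolic basis of eigenvectors of h ([hyperbolic_eigenpair]);
    so h lies in H^S. *)

Set Implicit Arguments.
Unset Strict Implicit.
Unset Printing Implicit Defensive.

Import GRing.Theory.
Local Open Scope ring_scope.

(** * Algebraically closed fields, polynomial maps and tangent directions *)

Section InfiniteField.
Variable K : closedFieldType.

Lemma exists_notin (s : seq K) : exists x, x \notin s.
Proof.
have [->|s0] := eqVneq s [::]; first by exists 0.
pose p := \prod_(a <- s) ('X - a%:P) + 1 : {poly K}.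
have sp : size p != 1%N.
  by rewrite /p size_polyDl size_prod_XsubC ?size_poly1 ?eqSS ?ltnS ?lt0n size_eq0.
have /closed_rootP [x px] := sp.
exists x; apply/negP => xs; move: px.
rewrite /root /p hornerD hornerC.
have /eqP -> : root (\prod_(a <- s) ('X - a%:P)) x by rewrite root_prod_XsubC.
by rewrite add0r oner_eq0.
Qed.

Lemma poly_zero_all (p : {poly K}) : (forall x, p.[x] = 0) -> p = 0.
Proof.
move=> p0; apply/eqP/negPn/negP => pn0.
have [r rE] := closed_field_poly_normal p.
have [x xr] := exists_notin r.
have := p0 x; rewrite rE hornerZ => /eqP; rewrite mulf_eq0 lead_coef_eq0 (negPf pn0) /=.
by rewrite -/(root _ _) root_prod_XsubC (negPf xr).
Qed.

Lemma poly_eq_off (p q : {poly K}) (s : seq K) :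
  (forall x, x \notin s -> p.[x] = q.[x]) -> p = q.
Proof.
move=> pq; apply/eqP; rewrite -subr_eq0.
have /eqP : (p - q) * \prod_(a <- s) ('X - a%:P) = 0.
  apply: poly_zero_all => x; rewrite hornerM hornerD hornerN.
  have [xs|xs] := boolP (x \in s); last by rewrite pq // subrr mul0r.
  have /eqP -> : root (\prod_(a <- s) ('X - a%:P)) x by rewrite root_prod_XsubC.
  by rewrite mulr0.
rewrite mulf_eq0 => /orP[->//|].
by rewrite (negPf (monic_neq0 (monic_prod_XsubC _ _ _))).
Qed.

Lemma exists_uniq_seq (s : seq K) m :
  exists r : seq K, [/\ size r = m, uniq r & forall x, x \in r -> x \notin s].
Proof.
elim: m => [|m [r [sr ur hr]]]; first by exists [::].
have [x] := exists_notin (r ++ s); rewrite mem_cat negb_or => /andP[xr xs].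
exists (x :: r); split; rewrite /= ?sr ?xr //.
by move=> y; rewrite inE => /orP[/eqP->|/hr].
Qed.

(** A nonzero power map is not constant on an infinite field: the zeros of
    z^a = 1 and the points of s are the roots of one nonzero polynomial. *)
Lemma exists_expz_neq1 (a : int) (s : seq K) : a != 0 ->
  exists z : K, [/\ z != 0, z \notin s & z ^ a != 1].
Proof.
move=> a0.
have [z] : exists z, ~~ root ('X * ('X^`|a|%N - 1) * \prod_(b <- s) ('X - b%:P)) z.
  apply: NNPP => H.
  have /eqP : 'X * ('X^`|a|%N - 1) * \prod_(b <- s) ('X - b%:P) = 0 :> {poly K}.
    by apply: poly_zero_all => x; apply/eqP/negPn/negP => hx; apply: H; exists x.
  rewrite !mulf_eq0 polyX_eq0 (negPf (monic_neq0 (monic_prod_XsubC _ _ _))) orbF /=.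
  by rewrite -size_poly_eq0 size_XnsubC // absz_gt0.
rewrite /root !hornerM !mulf_eq0 !negb_or => /andP[/andP[]].
rewrite hornerX => z0 za; rewrite -/(root _ _) root_prod_XsubC => zs.
exists z; split=> //; apply: contra za.
rewrite hornerD hornerN hornerXn hornerC subr_eq0.
by case: a {a0} => k //; rewrite NegzE -exprnN invr_eq1.
Qed.

Lemma exists_root_expz (y : K) (a : int) : y != 0 -> a != 0 ->
  exists2 z : K, z != 0 & z ^ a = y.
Proof.
have main (x : K) k : x != 0 -> (k != 0)%N -> exists2 z : K, z != 0 & z ^+ k = x.
  move=> x0 k0; have /closed_rootP [z] : size ('X^k - x%:P) != 1%N.
    by rewrite size_XnsubC ?lt0n.
  rewrite rootE !hornerE subr_eq0 => /eqP zx; exists z => //.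
  by apply: contraNneq x0 => z0; rewrite -zx z0 expr0n (negPf k0).
case: a => k y0 k0; first by apply: main.
have [|//|z z0 zk] := main y^-1 k.+1; first by rewrite invr_eq0.
by exists z => //; rewrite NegzE -exprnN zk invrK.
Qed.

End InfiniteField.

Section PolynomialFunctions.
Variables (K : closedFieldType) (n : nat).
Implicit Types f g : 'M[K]_n -> K.

(** The point of this definition, and of its matrix version below, is its closure
    under the ring operations, products, determinants and traces: it replaces
    explicit polynomials everywhere. *)
Definition polyfun f := exists p : {mpoly K[n * n]}, forall A, f A = p.@[mxpt A].

Lemma polyfun_ext f g : f =1 g -> polyfun f -> polyfun g.
Proof. by move=> fg [p pE]; exists p => A; rewrite -fg. Qed.

Lemma polyfun_const c : polyfun (fun=> c).
Proof. by exists c%:MP => A; rewrite mevalC. Qed.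

Lemma polyfun_entry i j : polyfun (fun A => A i j).
Proof. by exists 'X_(mxvec_index i j) => A; rewrite mevalXU /mxpt mxvecE. Qed.

Lemma polyfunD f g : polyfun f -> polyfun g -> polyfun (fun A => f A + g A).
Proof. by move=> [p pE] [q qE]; exists (p + q) => A; rewrite mevalD pE qE. Qed.

Lemma polyfunM f g : polyfun f -> polyfun g -> polyfun (fun A => f A * g A).
Proof. by move=> [p pE] [q qE]; exists (p * q) => A; rewrite mevalM pE qE. Qed.

Lemma polyfun_sum I (r : seq I) (P : pred I) (F : I -> 'M[K]_n -> K) :
  (forall i, polyfun (F i)) -> polyfun (fun A => \sum_(i <- r | P i) F i A).
Proof.
move=> hF; elim: r => [|i r IH].
  by apply: polyfun_ext (polyfun_const 0) => A; rewrite big_nil.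
case Pi : (P i); last by apply: polyfun_ext IH => A; rewrite big_cons Pi.
by apply: polyfun_ext (polyfunD (hF i) IH) => A; rewrite big_cons Pi.
Qed.

Lemma polyfun_prod I (r : seq I) (P : pred I) (F : I -> 'M[K]_n -> K) :
  (forall i, polyfun (F i)) -> polyfun (fun A => \prod_(i <- r | P i) F i A).
Proof.
move=> hF; elim: r => [|i r IH].
  by apply: polyfun_ext (polyfun_const 1) => A; rewrite big_nil.
case Pi : (P i); last by apply: polyfun_ext IH => A; rewrite big_cons Pi.
by apply: polyfun_ext (polyfunM (hF i) IH) => A; rewrite big_cons Pi.
Qed.

Definition polymx r s (f : 'M[K]_n -> 'M[K]_(r, s)) :=
  forall i j, polyfun (fun A => f A i j).

Lemma polymx_id : polymx id.
Proof. by move=> i j; apply: polyfun_entry. Qed.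

Lemma polymx_const r s (C : 'M[K]_(r, s)) : polymx (fun=> C).
Proof. by move=> i j; apply: polyfun_const. Qed.

Lemma polymxD r s (f g : 'M[K]_n -> 'M[K]_(r, s)) :
  polymx f -> polymx g -> polymx (fun A => f A + g A).
Proof.
move=> hf hg i j.
by apply: polyfun_ext (polyfunD (hf i j) (hg i j)) => A; rewrite mxE.
Qed.

Lemma polymxZ r s (c : 'M[K]_n -> K) (f : 'M[K]_n -> 'M[K]_(r, s)) :
  polyfun c -> polymx f -> polymx (fun A => c A *: f A).
Proof.
move=> hc hf i j.
by apply: polyfun_ext (polyfunM hc (hf i j)) => A; rewrite mxE.
Qed.

Lemma polymxN r s (f : 'M[K]_n -> 'M[K]_(r, s)) :
  polymx f -> polymx (fun A => - f A).
Proof.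
move=> hf i j.
by apply: polyfun_ext (polymxZ (polyfun_const (-1)) hf i j) => A; rewrite scaleN1r.
Qed.

Lemma polymxM r s t (f : 'M[K]_n -> 'M[K]_(r, s)) (g : 'M[K]_n -> 'M[K]_(s, t)) :
  polymx f -> polymx g -> polymx (fun A => f A *m g A).
Proof.
move=> hf hg i j.
have := polyfun_sum (index_enum _) xpredT (fun l => polyfunM (hf i l) (hg l j)).
by apply: polyfun_ext => A; rewrite mxE.
Qed.

Lemma polymx_tr r s (f : 'M[K]_n -> 'M[K]_(r, s)) :
  polymx f -> polymx (fun A => (f A)^T).
Proof. by move=> hf i j; apply: polyfun_ext (hf j i) => A; rewrite mxE. Qed.

Lemma polymxX r (f : 'M[K]_n -> 'M[K]_r) d :
  polymx f -> polymx (fun A => f A ^+ d).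
Proof.
move=> hf; elim: d => [|d IH] i j.
  by apply: polyfun_ext (polymx_const 1%:M i j) => A; rewrite expr0.
by apply: polyfun_ext (polymxM hf IH i j) => A; rewrite exprS.
Qed.

Lemma polyfun_det r (f : 'M[K]_n -> 'M[K]_r) :
  polymx f -> polyfun (fun A => \det (f A)).
Proof.
move=> hf; rewrite /determinant.
apply: polyfun_sum => s; apply: polyfunM; first exact: polyfun_const.
by apply: polyfun_prod.
Qed.

Lemma polyfun_trace r (f : 'M[K]_n -> 'M[K]_r) :
  polymx f -> polyfun (fun A => \tr (f A)).
Proof. by move=> hf; apply: polyfun_sum. Qed.

Lemma polymx_adj r (f : 'M[K]_n -> 'M[K]_r) :
  polymx f -> polymx (fun A => \adj (f A)).
Proof.
move=> hf i j.
have h : polyfun (fun A => cofactor (f A) j i).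
  rewrite /cofactor; apply: polyfunM; first exact: polyfun_const.
  apply: polyfun_det => a b.
  by apply: polyfun_ext (hf (lift j a) (lift i b)) => A; rewrite !mxE.
by apply: polyfun_ext h => A; rewrite mxE.
Qed.

Lemma polyfun_regular S f : polyfun f -> regular_on S f.
Proof. by move=> [p pE]; exists p, 0%N => s _; rewrite expr0 divr1. Qed.

Lemma zariski_closed_polyfun (I : Type) (F : I -> 'M[K]_n -> K) :
  (forall i, polyfun (F i)) -> zariski_closed (fun A => forall i, F i A = 0).
Proof.
move=> hF; exists (fun p => exists i, forall A, F i A = p.@[mxpt A]) => A.
split=> [h p [i <-]//|h i].
by have [p pE] := hF i; rewrite pE; apply: h; exists i.
Qed.

(** Let Z be the set of common zeros of all the polynomials that vanish on the
    part of Y outside U.  The principal neighbourhoods show that U avoids Z, and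
    a point of Y outside U lies in Z by construction. *)
Lemma zariski_open_local (Y U : 'M[K]_n -> Prop) :
  (forall A, U A -> Y A) ->
  (forall A, U A -> exists f, [/\ polyfun f, f A != 0
                                & forall C, Y C -> f C != 0 -> U C]) ->
  zariski_open_in Y U.
Proof.
move=> UY loc.
pose P (p : {mpoly K[n * n]}) := forall C, Y C -> ~ U C -> p.@[mxpt C] = 0.
exists (fun A => forall p, P p -> p.@[mxpt A] = 0); first by exists P.
move=> A; split=> [UA|[YA nZ]].
  split; first exact: UY.
  have [f [[p pE] fA fU]] := loc A UA => /(_ p) h.
  move: fA; rewrite pE h ?eqxx // => C YC nUC; apply/eqP/negPn/negP => pC.
  by apply: nUC; apply: fU; rewrite ?pE.
by apply: NNPP => nU; apply: nZ => p; apply.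
Qed.

(** The chain rule along the line A + z C, checked on constants and variables
    and propagated by the Leibniz rule.  It turns membership in the Lie algebra,
    defined by partial derivatives, into a statement on polynomials in z. *)
Lemma mderiv_line (p : {mpoly K[n * n]}) (A C : 'M[K]_n) :
  exists2 q : {poly K}, forall z, q.[z] = p.@[mxpt (A + z *: C)]
    & q`_1 = \sum_(i < n * n) (p^`M(i)).@[mxpt A] * mxpt C i.
Proof.
pose x i : {poly K} := (mxpt A i)%:P + (mxpt C i) *: 'X.
have xz i z : (x i).[z] = mxpt (A + z *: C) i.
  by rewrite /x !hornerE /mxpt linearD linearZ /= !mxE mulrC.
pose ev (q : {mpoly K[n * n]}) : {poly K} := mmap polyC x q.
have evz q z : (ev q).[z] = q.@[mxpt (A + z *: C)].
  rewrite /ev mevalE /mmap horner_sum; apply: eq_bigr => m _.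
  rewrite !hornerE /mmap1 horner_prod; congr (_ * _).
  by apply: eq_bigr => i _; rewrite horner_exp xz.
have evD : (ev p)^`() = \sum_(i < n * n) ev p^`M(i) * (x i)^`().
  rewrite /ev.
  elim/mpolyind: p => [|c m p _ _ IH].
    rewrite mmap0 derivC big1 // => i _; by rewrite mderiv0 mmap0 mul0r.
  rewrite mmapD derivD IH.
  under [in RHS]eq_bigr => i _ do rewrite mderivD mmapD mulrDl.
  rewrite big_split; congr (_ + _); rewrite -mul_mpolyC.
  have evM (a b : {mpoly K[n * n]}) : mmap polyC x (a * b) = mmap polyC x a * mmap polyC x b.
    by apply: rmorphM => a' b'; apply: mulrC.
  pose Q (q : {mpoly K[n * n]}) :=
    (mmap polyC x q)^`() = \sum_(i < n * n) mmap polyC x q^`M(i) * (x i)^`().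
  have QM a b : Q a -> Q b -> Q (a * b).
    rewrite /Q evM derivM => -> ->; rewrite mulr_suml mulr_sumr -big_split.
    apply: eq_bigr => i _; rewrite mderivM mmapD !evM mulrDl /=.
    by rewrite mulrAC; congr (_ + _); rewrite mulrA.
  have QC a : Q a%:MP.
    rewrite /Q mmapC derivC big1 // => i _; by rewrite mderivC mmap0 mul0r.
  have QX j : Q 'X_j.
    rewrite /Q mmapX mmap1U (bigD1 j) //= big1 => [|i ij].
      rewrite mderivX mnm1E eqxx scale1r -{1}[U_(j)%MM]add0m addmK mpolyX0.
      by rewrite -(mpolyC1) ?mmapC ?mul1r ?addr0.
    by rewrite mderivX mnm1E eq_sym (negPf ij) scale0r mmap0 mul0r.
  apply: (QM _ _ (QC c)); rewrite mpolyXE_id.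
  elim/big_ind: _ => [||j _]; [exact: (QC 1)|exact: QM|].
  by elim: (m j) => [|d Hd]; rewrite ?expr0 ?exprS; [exact: (QC 1)|exact: QM].
exists (ev p) => //.
have -> : (ev p)`_1 = (ev p)^`().[0] by rewrite horner_coef0 coef_deriv.
rewrite evD horner_sum; apply: eq_bigr => i _.
rewrite hornerM evz scale0r addr0; congr (_ * _).
by rewrite /x derivD derivC add0r derivZ derivX alg_polyC hornerC.
Qed.

End PolynomialFunctions.

Section MorePolynomialMaps.
Variables (K : closedFieldType) (n : nat).

Lemma polymx_diag m (f : 'M[K]_n -> 'rV[K]_m) :
  polymx f -> polymx (fun A => diag_mx (f A)).
Proof.
move=> hf i j; apply: polyfun_ext (polyfunM (hf 0 i) (polyfun_const n (i == j)%:R)) => A.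
by rewrite mulr_natr mxE.
Qed.

Lemma polymx_block_diag r s (f : 'M[K]_n -> 'M[K]_r) (g : 'M[K]_n -> 'M[K]_s) :
  polymx f -> polymx g -> polymx (fun A => block_mx (f A) 0 0 (g A)).
Proof.
move=> hf hg i j; rewrite -(splitK i) -(splitK j).
case: (split i) => i'; case: (split j) => j' /=.
- by apply: polyfun_ext (hf i' j') => A; rewrite block_mxEul.
- by apply: polyfun_ext (polyfun_const n 0) => A; rewrite block_mxEur mxE.
- by apply: polyfun_ext (polyfun_const n 0) => A; rewrite block_mxEdl mxE.
by apply: polyfun_ext (hg i' j') => A; rewrite block_mxEdr.
Qed.

Lemma zariski_closed_polymx r s (f : 'M[K]_n -> 'M[K]_(r, s)) :
  polymx f -> zariski_closed (fun A => f A = 0).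
Proof.
move=> hf.
have [P PE] := zariski_closed_polyfun (fun ij : 'I_r * 'I_s => hf ij.1 ij.2).
exists P => A; rewrite -PE; split=> [-> ij|h]; first by rewrite mxE.
by apply/matrixP => i j; rewrite mxE (h (i, j)).
Qed.

Lemma zariski_closedI (Z1 Z2 : 'M[K]_n -> Prop) :
  zariski_closed Z1 -> zariski_closed Z2 -> zariski_closed (fun A => Z1 A /\ Z2 A).
Proof.
move=> [P1 h1] [P2 h2]; exists (fun p => P1 p \/ P2 p) => A.
rewrite h1 h2; split=> [[a b] p []|h]; [exact: a|exact: b|].
by split=> p hp; apply: h; [left|right].
Qed.

End MorePolynomialMaps.

Ltac polymx_tac := repeat first
  [ assumption | exact: polymx_id | exact: polymx_const | exact: polyfun_const
  | apply: polymxM | apply: polymxD | apply: polymxN | apply: polymxZ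
  | apply: polymx_tr | apply: polymxX | apply: polymx_block_diag
  | apply: polymx_diag | apply: polymx_adj | apply: polyfun_det
  | apply: polyfun_trace ].

(** * Frames of a nondegenerate form and Witt's theorem *)

(** The columns of X lie in the column space of A, whose dimension is at most
    that of the space they span. *)
Lemma cols_eq_of_rank (F : fieldType) n r (A : 'M[F]_n) (X : 'M[F]_(n, r)) Z :
  X = A *m Z -> \rank X = r -> (\rank A <= r)%N -> exists Z', A = X *m Z'.
Proof.
move=> XE rX rA.
have sXA : (X^T <= A^T)%MS by rewrite XE trmx_mul submxMl.
have : (A^T <= X^T)%MS by rewrite -(geq_leqif (mxrank_leqif_sup sXA)) !mxrank_tr rX.
by case/submxP => Z' E; exists Z'^T; rewrite -(trmxK A) E trmx_mul trmxK.
Qed.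

Lemma rank_left_inv (F : fieldType) n r (X : 'M[F]_(n, r)) (Y : 'M[F]_(r, n)) :
  Y *m X = 1%:M -> \rank X = r.
Proof.
move=> YX; apply/eqP; rewrite eqn_leq rank_leq_col -{1}(mxrank1 F r) -YX.
exact: mxrankM_maxr.
Qed.

Lemma exists_col_neq0 (R : nzRingType) m n (A : 'M[R]_(m, n)) :
  A != 0 -> exists j, col j A != 0.
Proof.
move=> /matrix0Pn[i [j Aij]]; exists j; apply: contraNneq Aij => /colP/(_ i).
by rewrite !mxE => ->.
Qed.

Lemma form_cols (R : comNzRingType) n (B : 'M[R]_n) r s
    (U : 'M[R]_(n, r)) (W : 'M[R]_(n, s)) i j :
  (U^T *m B *m W) i j = ((col i U)^T *m B *m col j W) 0 0.
Proof.
have -> : (col i U)^T *m B *m col j W = row i (col j (U^T *m B *m W)).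
  by rewrite !colE !rowE trmx_mul trmx_delta !mulmxA.
by rewrite !mxE.
Qed.

Section Frames.
Variables (K : closedFieldType) (n : nat) (B : 'M[K]_n) (eps : bool).
Hypothesis two_neq0 : 2%:R != 0 :> K.
Hypothesis unitB : B \in unitmx.
Hypothesis symB : B^T = (-1) ^+ eps *: B.

Local Notation e := ((-1) ^+ eps : K).

Lemma sgn_mulK : e * e = 1.
Proof. by rewrite -expr2 sqrr_sign. Qed.

Lemma form_sym r s (X : 'M[K]_(n, r)) (Y : 'M[K]_(n, s)) :
  (X^T *m B *m Y)^T = e *: (Y^T *m B *m X).
Proof. by rewrite !trmx_mul trmxK symB -!scalemxAl -scalemxAr mulmxA. Qed.

Lemma form_sym0 r s (X : 'M[K]_(n, r)) (Y : 'M[K]_(n, s)) :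
  X^T *m B *m Y = 0 -> Y^T *m B *m X = 0.
Proof. by move=> XY; apply: trmx_inj; rewrite form_sym XY scaler0 trmx0. Qed.

Lemma isometriesV g : isometries B g -> isometries B (invmx g).
Proof.
move=> [ug Hg]; split; first by rewrite unitmx_inv.
rewrite -{1}Hg !mulmxA -trmx_mul mulmxV // trmx1 mul1mx.
by rewrite -mulmxA mulmxV // mulmx1.
Qed.

(** This makes the inverse of an isometry a polynomial in its entries. *)
Lemma isometries_inv g : isometries B g -> invmx g = invmx B *m g^T *m B.
Proof.
move=> [ug Hg]; apply: (can_inj (mulmxK ug)).
by rewrite mulVmx // -!mulmxA (mulmxA g^T) Hg mulVmx.
Qed.

Lemma isometriesP g : g^T *m B *m g = B -> isometries B g.
Proof.
move=> Hg; split=> //; have : g^T *m B *m g \in unitmx by rewrite Hg.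
by rewrite !unitmx_mul => /andP[].
Qed.

Lemma exists_dual (u : 'cV[K]_n) : u != 0 -> exists y : 'cV[K]_n, u^T *m B *m y = 1%:M.
Proof.
move=> u0.
have /rV0Pn[j vj] : u^T *m B != 0.
  apply: contraNneq u0 => E; rewrite -(trmxK u) -[u^T](mulmxK unitB) E mul0mx.
  by rewrite trmx0.
exists (((u^T *m B) 0 j)^-1 *: delta_mx j 0); rewrite -scalemxAr -colE.
apply/matrixP => a b; rewrite !ord1 !mxE mulrC mulfV //.
by move: vj; rewrite !mxE.
Qed.

Lemma isometry_adj g : isometries B g -> g^T *m B = B *m invmx g.
Proof. by move=> [ug gB]; apply: (can_inj (mulmxK ug)); rewrite gB mulmxKV. Qed.

Lemma isometry_adjV g : isometries B g -> (invmx g)^T *m B = B *m g.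
Proof. by move=> hg; rewrite (isometry_adj (isometriesV hg)) invmxK. Qed.

Definition frame r (X : 'M[K]_(n, r)) (G : 'M[K]_r) :=
  X^T *m B *m X = G /\ G \in unitmx.

(** The coordinates of the orthogonal projection onto the span of the frame.
    The definition is locked because rewriting with the associativity of the
    product would otherwise unfold it. *)
Definition coords r (X : 'M[K]_(n, r)) (G : 'M[K]_r) :=
  locked (invmx G *m X^T *m B).

Lemma coordsE r (X : 'M[K]_(n, r)) G : coords X G = invmx G *m X^T *m B.
Proof. by rewrite /coords -lock. Qed.

Lemma coordsK r (X : 'M[K]_(n, r)) G : frame X G -> coords X G *m X = 1%:M.
Proof. by move=> [XG uG]; rewrite coordsE -!mulmxA (mulmxA X^T) XG mulVmx. Qed.

Lemma rank_frame r (X : 'M[K]_(n, r)) G : frame X G -> \rank X = r.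
Proof. by move/coordsK; apply: rank_left_inv. Qed.

Lemma coords_eq0 r (X : 'M[K]_(n, r)) G s (v : 'M[K]_(n, s)) : frame X G ->
  (coords X G *m v = 0) <-> (X^T *m B *m v = 0).
Proof.
move=> [XG uG]; rewrite coordsE -!mulmxA; split=> [h|->]; last by rewrite mulmx0.
by rewrite -[LHS](mulKVmx uG) h mulmx0.
Qed.

(** The map with matrix D on the span of the frame and the identity on its
    orthogonal complement. *)
Definition frame_map r (X : 'M[K]_(n, r)) G D : 'M[K]_n :=
  1%:M + X *m (D - 1%:M) *m coords X G.

Section OneFrame.
Variables (r : nat) (X : 'M[K]_(n, r)) (G : 'M[K]_r).
Hypothesis XG : frame X G.

Lemma frame_map1 : frame_map X G 1%:M = 1%:M.
Proof. by rewrite /frame_map subrr mulmx0 mul0mx addr0. Qed.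

Lemma frame_map_frame D : frame_map X G D *m X = X *m D.
Proof.
rewrite /frame_map mulmxDl mul1mx -!mulmxA coordsK // mulmx1 mulmxBr mulmx1.
by rewrite addrC subrK.
Qed.

Lemma coords_frame_map D : coords X G *m frame_map X G D = D *m coords X G.
Proof.
rewrite /frame_map mulmxDr mulmx1 !mulmxA coordsK // mul1mx mulmxBl mul1mx.
by rewrite addrC subrK.
Qed.

Lemma frame_map_orth D s (v : 'M[K]_(n, s)) : X^T *m B *m v = 0 -> frame_map X G D *m v = v.
Proof.
move=> /(coords_eq0 v XG) Xv.
by rewrite /frame_map mulmxDl mul1mx -!mulmxA Xv !mulmx0 addr0.
Qed.

Lemma frame_mapM D D' : frame_map X G D *m frame_map X G D' = frame_map X G (D *m D').
Proof.
rewrite {1}/frame_map mulmxDl mul1mx -!mulmxA coords_frame_map {1}/frame_map -addrA.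
congr (_ + _).
rewrite !mulmxA -mulmxDl -mulmxA -mulmxDr; congr (_ *m _ *m _).
by rewrite mulmxBl mul1mx addrC addrA subrK.
Qed.

Lemma rank_frame_map_sub1 D : (\rank (frame_map X G D - 1%:M)%R <= r)%N.
Proof.
rewrite /frame_map addrC addKr -mulmxA (leq_trans (mxrankM_maxl _ _)) //.
exact: rank_leq_col.
Qed.

Lemma rank_sub1_ge h D : h *m X = X *m D -> D - 1%:M \in unitmx ->
  (r <= \rank (h - 1%:M)%R)%N.
Proof.
move=> hX uD; rewrite -{1}(rank_frame XG) -{1}(mulmxK uD X) mulmxBr mulmx1 -hX.
rewrite -{2}(mul1mx X) -mulmxBl -mulmxA; exact: mxrankM_maxl.
Qed.

Lemma form_coords : X^T *m B = G *m coords X G.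
Proof. by case: XG => _ uG; rewrite coordsE -!mulmxA mulKVmx. Qed.

Lemma gram_sym : G^T = e *: G.
Proof. by case: XG => <- _; rewrite form_sym. Qed.

Lemma form_coordsT : B *m X = (coords X G)^T *m G.
Proof.
apply: trmx_inj; rewrite !trmx_mul trmxK gram_sym symB -scalemxAr form_coords.
by rewrite -scalemxAl.
Qed.

Lemma frame_map_isometry D : D^T *m G *m D = G -> isometries B (frame_map X G D).
Proof.
move=> DG; apply: isometriesP; rewrite /frame_map.
set Y := coords X G; set C := D - 1%:M.
have hC : C^T *m G + G *m C + C^T *m G *m C = 0.
  rewrite /C linearB /= trmx1 !mulmxBl !mulmxBr DG !mulmx1 !mul1mx.
  by rewrite -(opprB _ G) -opprD subrr.
clearbody C; rewrite [(_ + _)^T]linearD /= trmx1 !trmx_mul.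
rewrite !mulmxDl !mul1mx !mulmxDr !mulmx1 -!addrA.
rewrite -[RHS]addr0; congr (_ + _).
have -> : B *m (X *m C *m Y) = Y^T *m (G *m C) *m Y.
  by rewrite !mulmxA form_coordsT.
have -> : Y^T *m (C^T *m X^T) *m B *m (X *m C *m Y) = Y^T *m (C^T *m G *m C) *m Y.
  by rewrite -!mulmxA (mulmxA B) (mulmxA X^T) (mulmxA X^T) XG.1.
have -> : Y^T *m (C^T *m X^T) *m B = Y^T *m (C^T *m G) *m Y.
  by rewrite -!mulmxA form_coords.
by rewrite -!mulmxDl -!mulmxDr addrA [X in Y^T *m (X + _)]addrC hC mulmx0 mul0mx.
Qed.

(** Since D - 1 is invertible, the image of h - 1 contains the span of X, hence
    equals it by the bound on the rank; and the coordinates of h v are D times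
    those of v because h is an isometry. *)
Lemma frame_map_recognize h D : isometries B h -> h *m X = X *m D ->
  D - 1%:M \in unitmx -> (\rank (h - 1%:M)%R <= r)%N -> h = frame_map X G D.
Proof.
move=> hh hX uD1 rh; set A := h - 1%:M.
have AX : A *m X = X *m (D - 1%:M) by rewrite mulmxBl mulmxBr mul1mx mulmx1 hX.
have [Z AE] : exists Z, A = X *m Z.
  apply: (@cols_eq_of_rank _ _ _ _ _ (X *m invmx (D - 1%:M))) rh; last exact: rank_frame XG.
  by rewrite mulmxA AX mulmxK.
have DGD : D^T *m G *m D = G.
  transitivity ((X *m D)^T *m B *m (X *m D)).
    by rewrite -XG.1 trmx_mul !mulmxA.
  rewrite -hX trmx_mul -!mulmxA (mulmxA h^T) (mulmxA (h^T *m B)) hh.2 mulmxA.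
  exact: XG.1.
have uD : D \in unitmx.
  have : D^T *m G *m D \in unitmx by rewrite DGD XG.2.
  by rewrite !unitmx_mul => /andP[].
have Yh : coords X G *m h = D *m coords X G.
  have XBh : (D^T *m X^T) *m B *m h = X^T *m B.
    by rewrite -trmx_mul -hX trmx_mul -!mulmxA (mulmxA _ B) hh.2.
  rewrite coordsE -!mulmxA; apply: (can_inj (mulKmx XG.2)).
  rewrite mulKVmx ?XG.2 //; apply: (can_inj (mulKmx (_ : D^T \in unitmx))).
    by rewrite unitmx_tr.
  by rewrite !mulmxA XBh DGD mulmxV ?mul1mx ?XG.2.
have -> : h = 1%:M + A by rewrite addrC addrNK.
rewrite /frame_map; congr (_ + _).
have <- : X *m (coords X G *m A) = A by rewrite {1}AE (mulmxA (coords _ _)) coordsK // mul1mx -AE.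
by rewrite mulmxBr Yh mulmx1 -{2}(mul1mx (coords X G)) -mulmxBl mulmxA.
Qed.

Lemma complement_nonzero : (r < n)%N -> exists2 u : 'cV[K]_n, u != 0 & X^T *m B *m u = 0.
Proof.
move=> rn; set Q := 1%:M - X *m coords X G.
have YQ : coords X G *m Q = 0 by rewrite mulmxBr mulmx1 mulmxA coordsK // mul1mx subrr.
have : Q != 0.
  apply: contraTneq rn => /eqP; rewrite subr_eq0 => /eqP E.
  rewrite -leqNgt -{1}(mxrank1 K n) E (leq_trans (mxrankM_maxl _ _)) //.
  exact: rank_leq_col.
move=> /exists_col_neq0[j Qj].
exists (col j Q) => //; apply/(coords_eq0 _ XG).
by rewrite colE mulmxA YQ mul0mx.
Qed.

Lemma complement_dual (u : 'cV[K]_n) : u != 0 -> X^T *m B *m u = 0 ->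
  exists2 w : 'cV[K]_n, X^T *m B *m w = 0 & u^T *m B *m w = 1%:M.
Proof.
move=> u0 Xu.
have [y uy] := exists_dual u0.
exists ((1%:M - X *m coords X G) *m y).
  apply/(coords_eq0 _ XG); rewrite mulmxA mulmxBr mulmx1 mulmxA coordsK //.
  by rewrite mul1mx subrr mul0mx.
rewrite mulmxA mulmxBr mulmx1 mulmxBl uy !mulmxA.
by rewrite (form_sym0 Xu) !mul0mx subr0.
Qed.

Lemma frame_extend s (Z : 'M[K]_(n, s)) H : frame Z H -> X^T *m B *m Z = 0 ->
  frame (row_mx X Z) (block_mx G 0 0 H).
Proof.
move=> ZH XZ; split; last by rewrite unitmxE det_ublock unitrM -!unitmxE XG.2 ZH.2.
rewrite tr_row_mx -!mulmxA mul_mx_row mul_col_row !mulmxA XG.1 ZH.1 XZ.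
by rewrite (form_sym0 XZ).
Qed.

End OneFrame.

Lemma sqr_root (a : K) : exists s, s * s = a.
Proof.
have /closed_rootP [s] : size ('X^2 - a%:P) != 1%N by rewrite size_XnsubC.
by rewrite rootE !hornerE subr_eq0 => /eqP; exists s; rewrite -expr2.
Qed.

(** In characteristic not two a nonzero symmetric form is not alternating: one of
    u, w, u + w is not isotropic when B(u, w) = 1. *)
Lemma form_nonisotropic r (X : 'M[K]_(n, r)) G : frame X G -> (r < n)%N -> eps = false ->
  exists2 z : 'cV[K]_n, X^T *m B *m z = 0 & z^T *m B *m z = 1%:M.
Proof.
move=> XG rn ep.
have norm (z : 'cV[K]_n) : z^T *m B *m z != 0 -> exists c, (c *: z)^T *m B *m (c *: z) = 1%:M.
  rewrite [z^T *m B *m z]mx11_scalar; set a := (_ 0 0) => z0.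
  have [s sE] := sqr_root a^-1; exists s.
  rewrite [(_ *: _)^T]linearZ /= -!scalemxAl -scalemxAr scalerA sE.
  rewrite [z^T *m B *m z]mx11_scalar -/a scale_scalar_mx mulVf //.
  by apply: contraNneq z0 => ->; rewrite raddf0.
suff [z z1 z2] : exists2 z : 'cV[K]_n, X^T *m B *m z = 0 & z^T *m B *m z != 0.
  have [c hc] := norm z z2; exists (c *: z) => //.
  by rewrite -scalemxAr z1 scaler0.
have [u u0 Xu] := complement_nonzero XG rn.
have [w Xw uw] := complement_dual XG u0 Xu.
have [uu|uu] := eqVneq (u^T *m B *m u) 0; last by exists u.
have [ww|ww] := eqVneq (w^T *m B *m w) 0; last by exists w.
exists (u + w); first by rewrite mulmxDr Xu Xw addr0.
rewrite [(_ + _)^T]linearD /= !mulmxDl !mulmxDr uu ww uw add0r addr0.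
have -> : w^T *m B *m u = 1%:M.
  apply: trmx_inj; rewrite form_sym uw ep scale1r trmx1 //.
by rewrite -mulr2n -scaler_nat scaler_eq0 (negPf two_neq0) oner_eq0.
Qed.

(** By induction on the codimension, both frames are enlarged by pieces of the
    same Gram matrix taken in the complements: a vector of norm 1 in the symmetric
    case, a hyperbolic pair in the alternating one.  For frames that are bases, the
    change of basis is the isometry. *)
Lemma witt r (X X' : 'M[K]_(n, r)) G : frame X G -> frame X' G ->
  exists2 x, isometries B x & x *m X = X'.
Proof.
have [q] := ubnP (n - r); elim: q r X X' G => // q IH r X X' G hq XG XG'.
have rn : (r <= n)%N by rewrite -(rank_frame XG) rank_leq_row.
have [nr|{}rn] : n = r \/ (r < n)%N by case: ltngtP rn => //; auto.
  move: XG XG'; rewrite -{}nr in X X' G hq * => XG XG'.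
  have X_Y : X *m coords X G = 1%:M by apply: mulmx1C; rewrite coordsK.
  exists (X' *m coords X G); last by rewrite -mulmxA coordsK // mulmx1.
  apply: isometriesP; rewrite trmx_mul -!mulmxA (mulmxA B) (mulmxA X'^T).
  rewrite (mulmxA X'^T B) XG'.1 -form_coords // !mulmxA -trmx_mul.
  by rewrite X_Y trmx1 mul1mx.
have step s (Z Z' : 'M[K]_(n, s)) H : (0 < s)%N -> frame Z H -> frame Z' H ->
    X^T *m B *m Z = 0 -> X'^T *m B *m Z' = 0 ->
    exists2 x, isometries B x & x *m X = X'.
  move=> s0 ZH ZH' XZ XZ'.
  have [|x hx] := IH _ _ _ _ _ (frame_extend XG ZH XZ) (frame_extend XG' ZH' XZ').
    rewrite (leq_trans _ (hq : (n - r <= q)%N)) // subnDA ltn_subrL s0 subn_gt0.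
    exact: rn.
  by rewrite mul_mx_row => /eq_row_mx [xX _]; exists x.
case ep : eps; last first.
  have [z Xz zz] := form_nonisotropic XG rn ep.
  have [z' Xz' zz'] := form_nonisotropic XG' rn ep.
  by apply: (step _ z z' 1%:M _ _ _ Xz Xz') => //; split=> //; exact: unitmx1.
have pair (Y : 'M[K]_(n, r)) : frame Y G -> exists2 Z : 'M[K]_(n, 1 + 1),
    Y^T *m B *m Z = 0 & frame Z (block_mx 0 1%:M (- 1%:M) 0).
  move=> YG; have [u u0 Yu] := complement_nonzero YG rn.
  have [w Yw uw] := complement_dual YG u0 Yu.
  have skew (v : 'cV[K]_n) : v^T *m B *m v = 0.
    have : (v^T *m B *m v)^T = - (v^T *m B *m v) by rewrite form_sym ep scaleN1r.
    move=> /matrixP/(_ 0 0); rewrite !mxE => /eqP; rewrite -subr_eq0 opprK -mulr2n.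
    rewrite -mulr_natl mulf_eq0 (negPf two_neq0) /= => /eqP h.
    by apply/matrixP => i j; rewrite !ord1 !mxE.
  exists (row_mx u w); first by rewrite mul_mx_row Yu Yw row_mx0.
  split; last first.
    have /mulmx1_unit[] // : block_mx 0 1%:M (- 1%:M) 0 *m block_mx 0 (- 1%:M) 1%:M 0
      = 1%:M :> 'M[K]_(1 + 1).
    by rewrite mulmx_block !mul0mx !mulmx0 !mulmx1 mulmxN mulNmx mulmx1 opprK !addr0 !add0r
               -scalar_mx_block.
  rewrite tr_row_mx -!mulmxA mul_mx_row mul_col_row !mulmxA !skew uw.
  congr block_mx; apply: trmx_inj; rewrite form_sym uw ep scaleN1r linearN /= trmx1 //.
have [Z XZ ZH] := pair _ XG; have [Z' XZ' ZH'] := pair _ XG'.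
exact: (step _ Z Z' _ _ ZH ZH').
Qed.

End Frames.

(** * Hyperbolic families and their diagonal tori *)

Section DiagonalTorus.
Variable K : closedFieldType.

(** The points of the diagonal torus are row vectors t with nonzero entries,
    multiplied entrywise. *)
Definition torus_pt m (t : 'rV[K]_m) := forall i, t 0 i != 0.
Definition tmul m (t t' : 'rV[K]_m) := \row_i (t 0 i * t' 0 i).
Definition tinv m (t : 'rV[K]_m) := \row_i (t 0 i)^-1.

Lemma torus_pt_tmul m (t t' : 'rV[K]_m) : torus_pt t -> torus_pt t' -> torus_pt (tmul t t').
Proof. by move=> ht ht' i; rewrite mxE mulf_neq0. Qed.

Lemma torus_pt_tinv m (t : 'rV[K]_m) : torus_pt t -> torus_pt (tinv t).
Proof. by move=> ht i; rewrite mxE invr_eq0. Qed.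

Lemma torus_pt_const m (z : K) : z != 0 -> torus_pt (const_mx z : 'rV_m).
Proof. by move=> z0 i; rewrite mxE. Qed.

Lemma tmulV m (t : 'rV[K]_m) : torus_pt t -> tmul t (tinv t) = const_mx 1.
Proof. by move=> ht; apply/rowP => i; rewrite !mxE mulfV. Qed.

Lemma diag_const1 m : diag_mx (const_mx 1 : 'rV[K]_m) = 1%:M.
Proof. by rewrite diag_const_mx. Qed.

Lemma diag_tmul m (t t' : 'rV[K]_m) : diag_mx (tmul t t') = diag_mx t *m diag_mx t'.
Proof. by rewrite mulmx_diag. Qed.

Lemma diag_unit m (t : 'rV[K]_m) : (diag_mx t \in unitmx) <-> torus_pt t.
Proof.
rewrite unitmxE det_diag unitfE; split=> [/prodf_neq0 h i|h]; first exact: h.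
by apply/prodf_neq0 => i _; apply: h.
Qed.

Lemma invmx_diag m (t : 'rV[K]_m) : torus_pt t -> invmx (diag_mx t) = diag_mx (tinv t).
Proof.
move=> ht; have u := (diag_unit t).2 ht.
by rewrite -[RHS](mulKmx u) -diag_tmul tmulV // diag_const1 mulmx1.
Qed.

Lemma diag_groupP m (D : 'M[K]_m) : diag_group D <-> exists2 t, torus_pt t & D = diag_mx t.
Proof.
split=> [/andP[/is_diag_mxP/= h u]|[t ht ->]].
  have DE : D = diag_mx (\row_i D i i).
    apply/matrixP => i j; rewrite !mxE; have [->|ij] := eqVneq i j; first by rewrite mulr1n.
    by rewrite mulr0n h.
  by exists (\row_i D i i) => //; apply/diag_unit; rewrite -DE.
by rewrite /diag_group diag_mx_is_diag (diag_unit t).2.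
Qed.

Lemma col_mul_diag n m (U : 'M[K]_(n, m)) t i :
  col i (U *m diag_mx t) = t 0 i *: col i U.
Proof. by apply/matrixP => a b; rewrite mul_mx_diag !mxE mulrC. Qed.

Lemma mul_diag_cols n m (g : 'M[K]_n) (U : 'M[K]_(n, m)) (t : 'rV[K]_m) :
  (forall i, g *m col i U = t 0 i *: col i U) -> g *m U = U *m diag_mx t.
Proof.
move=> h; apply/matrixP => a i.
have := h i; rewrite colE mulmxA -!colE => /matrixP/(_ a 0).
by rewrite mul_mx_diag [LHS]mxE => ->; rewrite !mxE mulrC.
Qed.

End DiagonalTorus.

Section Hyperbolic.
Variables (K : closedFieldType) (n : nat) (B : 'M[K]_n) (eps : bool).
Hypothesis two_neq0 : 2%:R != 0 :> K.
Hypothesis unitB : B \in unitmx.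
Hypothesis symB : B^T = (-1) ^+ eps *: B.

Local Notation e := ((-1) ^+ eps : K).
Local Notation form_sym := (form_sym symB).
Local Notation form_sym0 := (form_sym0 symB).

Definition hyperbolic m (U W : 'M[K]_(n, m)) :=
  [/\ U^T *m B *m U = 0, W^T *m B *m W = 0 & U^T *m B *m W = 1%:M].

Definition hyperbolic_gram m : 'M[K]_(m + m) := block_mx 0 1%:M (e *: 1%:M) 0.

Lemma hyperbolic_gram_unit m : hyperbolic_gram m \in unitmx.
Proof.
have /mulmx1_unit[] // : hyperbolic_gram m *m block_mx 0 (e *: 1%:M) 1%:M 0 = 1%:M.
rewrite mulmx_block !mul0mx !mulmx0 !mulmx1 ?mul1mx !addr0 !add0r.
by rewrite -scalemxAl mul1mx scalerA sgn_mulK scale1r -scalar_mx_block.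
Qed.

Lemma hyperbolic_WU m (U W : 'M[K]_(n, m)) : hyperbolic U W -> W^T *m B *m U = e *: 1%:M.
Proof. by case=> _ _ UW; apply: trmx_inj; rewrite form_sym UW linearZ /= trmx1. Qed.

Lemma hyperbolic_frame m (U W : 'M[K]_(n, m)) :
  hyperbolic U W <-> frame B (row_mx U W) (hyperbolic_gram m).
Proof.
split=> [H|[]]; last first.
  rewrite tr_row_mx -!mulmxA mul_mx_row mul_col_row !mulmxA => /eq_block_mx[].
  by move=> ? ? _ ? _; split.
have WU := hyperbolic_WU H; case: H => UU WW UW; split; last exact: hyperbolic_gram_unit.
by rewrite tr_row_mx -!mulmxA mul_mx_row mul_col_row !mulmxA UU UW WU WW.
Qed.

(** A plane in the orthogonal complement contains a nonzero isotropic vector u, as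
    a quadratic equation has a root; a vector w with B(u, w) = 1 becomes isotropic
    after subtracting a multiple of u. *)
Lemma exists_hyperbolic m : (m + m <= n)%N -> exists U W : 'M[K]_(n, m), hyperbolic U W.
Proof.
elim: m => [_|m IH mn].
  by exists 0, 0; split; apply/matrixP => i [].
have [|U [W UW]] := IH; first by rewrite (leq_trans _ mn) // leq_add.
have XG := (hyperbolic_frame U W).1 UW.
have rn : ((m + m).+1 < n)%N by rewrite addnS addSn in mn.
have [u [u0 Xu uu]] : exists u : 'cV[K]_n,
    [/\ u != 0, (row_mx U W)^T *m B *m u = 0 & u^T *m B *m u = 0].
  have [a a0 Xa] := complement_nonzero XG (ltnW rn).
  have [aa|aa] := eqVneq (a^T *m B *m a) 0; first by exists a.
  rewrite [a^T *m B *m a]mx11_scalar in aa; set al := (_ 0 0) in aa.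
  have al0 : al != 0 by apply: contraNneq aa => ->; rewrite raddf0.
  have aG : frame B a al%:M.
    by split; [exact: mx11_scalar | rewrite unitmxE det_scalar1 unitfE].
  have [|b b0] := complement_nonzero (frame_extend symB XG aG Xa).
    by rewrite addn1.
  rewrite tr_row_mx mul_col_mx mul_col_mx -col_mx0 => /eq_col_mx[Xb ab].
  (* a and b are orthogonal and a is not isotropic: solve B(s a + b, s a + b) = 0. *)
  pose be := (b^T *m B *m b) 0 0.
  have bb : b^T *m B *m b = be%:M by exact: mx11_scalar.
  have [s sE] := sqr_root (- be / al).
  exists (s *: a + b); split.
  - apply: contraNneq b0 => E.
    have : a^T *m B *m (s *: a + b) = 0 by rewrite E mulmx0.
    rewrite mulmxDr ab addr0 -scalemxAr => /eqP; rewrite scaler_eq0.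
    have -> : (a^T *m B *m a == 0) = false.
      by apply/negbTE; rewrite [X in X == 0]mx11_scalar.
    by rewrite orbF => /eqP s0; rewrite -E s0 scale0r add0r.
  - by rewrite mulmxDr Xb -scalemxAr Xa scaler0 addr0.
  rewrite [(_ + _)^T]linearD /= [(_ *: _)^T]linearZ /= !mulmxDl !mulmxDr.
  rewrite -!scalemxAl -!scalemxAr ab (form_sym0 ab) scaler0 addr0 add0r scalerA sE.
  rewrite [a^T *m B *m a]mx11_scalar bb -/al.
  by rewrite scale_scalar_mx divfK // -raddfD /= addNr raddf0.
have [w Xw uw] := complement_dual unitB symB XG u0 Xu.
have [w' [Xw' uw' ww']] : exists w' : 'cV[K]_n, [/\ (row_mx U W)^T *m B *m w' = 0,
    u^T *m B *m w' = 1%:M & w'^T *m B *m w' = 0].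
  (* In the alternating case this constant is zero. *)
  pose c := (2%:R)^-1 * (w^T *m B *m w) 0 0.
  exists (w - c *: u); split.
  - by rewrite mulmxBr Xw -scalemxAr Xu scaler0 subr0.
  - by rewrite mulmxBr uw -scalemxAr uu scaler0 subr0.
  have wu : w^T *m B *m u = e%:M.
    by apply: trmx_inj; rewrite form_sym uw tr_scalar_mx scalemx1.
  rewrite [(_ - _)^T]linearB /= [(_ *: _)^T]linearZ /= !mulmxBl !mulmxBr.
  rewrite -!scalemxAl -!scalemxAr uu uw wu !scaler0 subr0.
  rewrite [w^T *m B *m w]mx11_scalar !scale_scalar_mx mulr1 -!raddfB /=.
  have -> : (w^T *m B *m w) 0 0 - c * e - c = 0; last by rewrite raddf0.
  rewrite /c; case: eps symB => sB; last first.
    have half : 2%:R^-1 + 2%:R^-1 = 1 :> K by rewrite -mulr2n -[LHS]mulr_natr mulVf.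
    by rewrite expr0 mulr1 -addrA -opprD -mulrDl half mul1r subrr.
  have : (w^T *m B *m w)^T = - (w^T *m B *m w).
    by rewrite !trmx_mul trmxK sB scaleN1r mulNmx mulmxN mulmxA.
  move=> /matrixP/(_ 0 0); rewrite mxE [RHS]mxE => /eqP.
  rewrite -subr_eq0 opprK -mulr2n -[_ *+ 2]mulr_natl mulf_eq0 (negPf two_neq0) /= => /eqP ->.
  by rewrite mulr0 mul0r !subr0.
suff H : @hyperbolic (1 + m)%N (row_mx u U) (row_mx w' W).
  by exists (row_mx u U), (row_mx w' W).
move: Xu Xw'; rewrite tr_row_mx !mul_col_mx -!col_mx0.
move=> /eq_col_mx[Uu Wu] /eq_col_mx[Uw Ww]; case: UW => UU WW UW.
split; rewrite tr_row_mx mul_col_mx mul_col_row.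
- by rewrite uu UU Uu (form_sym0 Uu) block_mx0.
- by rewrite ww' WW Ww (form_sym0 Ww) block_mx0.
by rewrite uw' UW Uw (form_sym0 Wu) -scalar_mx_block.
Qed.

Definition torus_block m (t : 'rV[K]_m) : 'M[K]_(m + m) :=
  block_mx (diag_mx t) 0 0 (diag_mx (tinv t)).

Lemma torus_block1 m : torus_block (const_mx 1 : 'rV[K]_m) = 1%:M.
Proof.
rewrite /torus_block diag_const1.
have -> : tinv (const_mx 1 : 'rV[K]_m) = const_mx 1.
  by apply/rowP => i; rewrite !mxE invr1.
by rewrite diag_const1 -scalar_mx_block.
Qed.

Lemma torus_blockM m (t t' : 'rV[K]_m) : torus_block t *m torus_block t' = torus_block (tmul t t').
Proof.
rewrite /torus_block mulmx_block !mulmx0 !mul0mx !addr0 !add0r -!diag_tmul.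
by congr (block_mx _ _ _ (diag_mx _)); apply/rowP => i; rewrite !mxE invfM.
Qed.

Lemma torus_block_isometry m (t : 'rV[K]_m) : torus_pt t ->
  (torus_block t)^T *m hyperbolic_gram m *m torus_block t = hyperbolic_gram m.
Proof.
move=> ht; rewrite /torus_block tr_block_mx !tr_diag_mx !trmx0 /hyperbolic_gram.
rewrite !mulmx_block !mulmx0 !mul0mx !addr0 !add0r !mulmx1 ?mul0mx ?mulmx0.
rewrite -scalemxAr mulmx1 -scalemxAl -!diag_tmul tmulV // diag_const1.
have -> : tmul (tinv t) t = const_mx 1.
  by rewrite -(tmulV ht); apply/rowP => i; rewrite !mxE mulrC.
by rewrite diag_const1.
Qed.

Lemma torus_block_sub1_unit m (t : 'rV[K]_m) : torus_pt t -> (forall i, t 0 i != 1) ->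
  torus_block t - 1%:M \in unitmx.
Proof.
move=> ht h1; rewrite /torus_block.
have -> : 1%:M = block_mx 1%:M 0 0 1%:M :> 'M[K]_(m + m) by exact: scalar_mx_block.
rewrite opp_block_mx add_block_mx.
rewrite !oppr0 !addr0 unitmxE det_ublock unitrM -!unitmxE.
have dB (s : 'rV[K]_m) : diag_mx s - 1%:M = diag_mx (s - const_mx 1).
  by rewrite linearB /= diag_const1.
apply/andP; split; rewrite dB; apply/diag_unit => i; rewrite !mxE subr_eq0 //.
by rewrite invr_eq1.
Qed.

(** It multiplies u_i by t_i and w_i by t_i^-1 and fixes the orthogonal
    complement. *)
Definition torus_elt m (U W : 'M[K]_(n, m)) (t : 'rV[K]_m) : 'M[K]_n :=
  frame_map B (row_mx U W) (hyperbolic_gram m) (torus_block t).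

Section OneFamily.
Variables (m : nat) (U W : 'M[K]_(n, m)).
Hypothesis UW : hyperbolic U W.
Let XG := (hyperbolic_frame U W).1 UW.

Lemma tor_isometry t : torus_pt t -> isometries B (torus_elt U W t).
Proof. by move=> ht; apply: (frame_map_isometry unitB symB XG); apply: torus_block_isometry. Qed.

Lemma tor1 : torus_elt U W (const_mx 1) = 1%:M.
Proof. by rewrite /torus_elt torus_block1 frame_map1. Qed.

Lemma torM t t' : torus_elt U W t *m torus_elt U W t' = torus_elt U W (tmul t t').
Proof. by rewrite /torus_elt frame_mapM // torus_blockM. Qed.

Lemma torV t : torus_pt t -> invmx (torus_elt U W t) = torus_elt U W (tinv t).
Proof.
move=> ht; have [u _] := tor_isometry ht.
by rewrite -[RHS](mulKmx u) torM tmulV // tor1 mulmx1.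
Qed.

Lemma tor_frame t : torus_elt U W t *m row_mx U W = row_mx U W *m torus_block t.
Proof. exact: frame_map_frame. Qed.

Lemma tor_U t : torus_elt U W t *m U = U *m diag_mx t.
Proof.
have := tor_frame t; rewrite mul_mx_row mul_row_block !mulmx0 addr0.
by case/eq_row_mx.
Qed.

Lemma tor_W t : torus_elt U W t *m W = W *m diag_mx (tinv t).
Proof.
have := tor_frame t; rewrite mul_mx_row mul_row_block !mulmx0 add0r.
by case/eq_row_mx.
Qed.

Lemma rank_tor t : (\rank (torus_elt U W t - 1%:M)%R <= m + m)%N.
Proof. exact: rank_frame_map_sub1. Qed.

Lemma rank_tor_eq t : torus_pt t -> (forall i, t 0 i != 1) ->
  \rank (torus_elt U W t - 1%:M) = (m + m)%N.
Proof.
move=> ht h1; have uD := torus_block_sub1_unit ht h1.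
apply/eqP; rewrite eqn_leq rank_tor /=.
exact: (rank_sub1_ge XG (tor_frame t) uD).
Qed.

Lemma tor_recognize h t : isometries B h -> torus_pt t -> (forall i, t 0 i != 1) ->
  h *m U = U *m diag_mx t -> h *m W = W *m diag_mx (tinv t) ->
  (\rank (h - 1%:M)%R <= m + m)%N -> h = torus_elt U W t.
Proof.
move=> hh ht h1 hU hW rh; apply: (frame_map_recognize XG hh) rh; last exact: torus_block_sub1_unit.
by rewrite mul_mx_row mul_row_block !mulmx0 addr0 add0r hU hW.
Qed.

End OneFamily.

Lemma hyperbolic_image m (U W : 'M[K]_(n, m)) x : isometries B x -> hyperbolic U W ->
  hyperbolic (x *m U) (x *m W).
Proof.
move=> [_ hx] [UU WW UW].
have E (V V' : 'M[K]_(n, m)) : (x *m V)^T *m B *m (x *m V') = V^T *m B *m V'.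
  by rewrite trmx_mul -!mulmxA (mulmxA B) (mulmxA x^T) (mulmxA x^T) hx.
by split; rewrite E.
Qed.

Lemma tor_image m (U W : 'M[K]_(n, m)) x t : isometries B x ->
  torus_elt (x *m U) (x *m W) t = x *m torus_elt U W t *m invmx x.
Proof.
move=> hx; rewrite /torus_elt /frame_map -mul_mx_row mulmxDr mulmxDl mulmx1 mulmxV ?hx.1 // !mulmxA.
congr (_ + _); rewrite -!mulmxA; congr (_ *m (_ *m (_ *m _))).
by rewrite !coordsE trmx_mul -!mulmxA isometry_adj.
Qed.

(** Witt's theorem for the two families, seen as frames with the same Gram matrix. *)
Lemma tor_conj m (U W U' W' : 'M[K]_(n, m)) : hyperbolic U W -> hyperbolic U' W' ->
  exists2 x, isometries B x & forall t, torus_elt U' W' t = x *m torus_elt U W t *m invmx x.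
Proof.
move=> UW UW'; have XG := (hyperbolic_frame U W).1 UW; have XG' := (hyperbolic_frame U' W').1 UW'.
have [x hx] := witt two_neq0 unitB symB XG XG'.
rewrite mul_mx_row => /eq_row_mx[<- <-]; exists x => // t.
exact: tor_image.
Qed.

End Hyperbolic.

(** * The standard torus is a torus *)

Section StandardTorus.
Variables (K : closedFieldType) (n : nat) (B : 'M[K]_n) (eps : bool).
Hypothesis two_neq0 : 2%:R != 0 :> K.
Hypothesis unitB : B \in unitmx.
Hypothesis symB : B^T = (-1) ^+ eps *: B.
Variables (m : nat) (U W : 'M[K]_(n, m)).
Hypothesis UW : hyperbolic B U W.

Local Notation e := ((-1) ^+ eps : K).
Local Notation tor := (torus_elt B eps U W).

Definition std_torus s := exists2 t, torus_pt t & s = tor t.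

(** On the standard torus this row recovers the parameter t, through polynomials
    in the entries that make sense for every matrix. *)
Definition weights (s : 'M[K]_n) : 'rV[K]_m :=
  \row_i (e *: (W^T *m B *m s *m U)) i i.
Definition inv_weights (s : 'M[K]_n) : 'rV[K]_m := \row_i (U^T *m B *m s *m W) i i.

Lemma weights_tor t : weights (tor t) = t.
Proof.
apply/rowP => i; rewrite mxE -mulmxA (tor_U symB UW) mulmxA (hyperbolic_WU symB UW).
by rewrite -scalemxAl mul1mx scalerA sgn_mulK scale1r mxE eqxx.
Qed.

Lemma inv_weights_tor t : inv_weights (tor t) = tinv t.
Proof.
apply/rowP => i; rewrite mxE -mulmxA (tor_W symB UW) mulmxA.
by case: UW => _ _ ->; rewrite mul1mx mxE eqxx mulr1n.
Qed.

Lemma polymx_weights : polymx weights.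
Proof.
move=> a i; apply: (@polyfun_ext _ _ (fun s => (e *: (W^T *m B *m s *m U)) i i)).
  by move=> s; rewrite [RHS]mxE.
have h : polymx (fun s => e *: (W^T *m B *m s *m U)) by polymx_tac.
exact: h.
Qed.

Lemma polymx_inv_weights : polymx inv_weights.
Proof.
move=> a i; apply: (@polyfun_ext _ _ (fun s => (U^T *m B *m s *m W) i i)).
  by move=> s; rewrite [RHS]mxE.
have h : polymx (fun s => U^T *m B *m s *m W) by polymx_tac.
exact: h.
Qed.

(** The torus is cut out by the equations which say that s is the torus element
    rebuilt from the weights and the inverse weights read off on s, and that these
    are inverse to each other. *)
Lemma std_torus_closed_subgroup : closed_subgroup std_torus.
Proof.
split.
- by exists (const_mx 1); [apply: torus_pt_const; apply: oner_neq0|rewrite tor1].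
- move=> _ _ [t ht ->] [t' ht' ->]; exists (tmul t t'); first exact: torus_pt_tmul.
  exact: (torM symB UW).
- move=> _ [t ht ->]; exists (tinv t); first exact: torus_pt_tinv.
  exact: (torV unitB symB UW).
pose D s := block_mx (diag_mx (weights s)) 0 0 (diag_mx (inv_weights s)).
exists (fun s => s - frame_map B (row_mx U W) (hyperbolic_gram K eps m) (D s) = 0 /\
                 tmul (weights s) (inv_weights s) - const_mx 1 = 0).
  have hw := polymx_weights; have hw' := polymx_inv_weights.
  apply: zariski_closedI; apply: zariski_closed_polymx.
    by rewrite /frame_map /D; polymx_tac.
  apply: polymxD; last exact: polymx_const.
  move=> a i; apply: polyfun_ext (polyfunM (hw 0 i) (hw' 0 i)).
  by move=> s; rewrite [RHS]mxE.
move=> s; split=> [[t ht ->]|[us [/eqP + /eqP]]].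
  split; first by case: (tor_isometry unitB symB UW ht).
  by rewrite /D weights_tor inv_weights_tor tmulV // !subrr.
rewrite !subr_eq0 => /eqP sE /eqP/rowP ww.
have {}ww i : weights s 0 i * inv_weights s 0 i = 1.
  by have := ww i; rewrite [LHS]mxE [RHS]mxE.
have w0 i : weights s 0 i != 0.
  by apply: contra_eq_neq (ww i) => ->; rewrite mul0r eq_sym oner_eq0.
exists (weights s) => //.
rewrite {1}sE /torus_elt /torus_block /D; congr (frame_map _ _ _ (block_mx _ _ _ (diag_mx _))).
by apply/rowP => i; rewrite [RHS]mxE; apply: (mulfI (w0 i)); rewrite ww mulfV.
Qed.

(** The parametrization is regular: the inverse of a diagonal matrix is its
    adjugate divided by its determinant. *)
Lemma std_torus_is_torus : is_torus std_torus m.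
Proof.
split; first exact: std_torus_closed_subgroup.
exists (fun s => diag_mx (weights s)), (fun D => tor (\row_i D i i)).
have dg (t : 'rV[K]_m) : \row_i (diag_mx t) i i = t.
  by apply/rowP => i; rewrite !mxE eqxx mulr1n.
split.
- split.
  + by move=> _ [t ht ->]; apply/diag_groupP; exists t; rewrite ?weights_tor.
  + move=> _ _ [t ht ->] [t' ht' ->].
    by rewrite (torM symB UW) !weights_tor diag_tmul.
  by move=> i j; apply: polyfun_regular; apply: polymx_diag; apply: polymx_weights.
- split.
  + by move=> _ /diag_groupP[t ht ->]; exists t; rewrite ?dg.
  + move=> _ _ /diag_groupP[t ht ->] /diag_groupP[t' ht' ->].
    by rewrite -diag_tmul !dg (torM symB UW).
  move=> i j; pose X := row_mx U W; pose Y := coords B X (hyperbolic_gram K eps m).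
  pose N (D : 'M[K]_m) := \det D *: 1%:M +
    X *m (block_mx (\det D *: D) 0 0 (\adj D) - \det D *: 1%:M) *m Y.
  have [p pE] : polyfun (fun D => N D i j).
    have hd : polyfun (fun D : 'M[K]_m => \det D) by polymx_tac.
    have h : polymx N by rewrite /N; polymx_tac.
    exact: h.
  exists p, 1%N => _ /diag_groupP[t ht ->]; rewrite -pE expr1 dg.
  have u : diag_mx t \in unitmx by apply/diag_unit.
  have d0 : \det (diag_mx t) != 0 by rewrite -unitfE -unitmxE.
  have -> : N (diag_mx t) = \det (diag_mx t) *: tor t; last first.
    by rewrite [X in _ = X / _]mxE mulrC mulKf.
  rewrite /N /torus_elt /frame_map scalerDr -/X -/Y; congr (_ + _).
  rewrite scalemxAl scalemxAr; congr (_ *m _ *m _).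
  rewrite scalerBr; congr (_ - _); rewrite /torus_block scale_block_mx !scaler0.
  congr block_mx; rewrite -invmx_diag // /invmx u scalerA mulfV // scale1r //.
- by move=> _ [t ht ->]; rewrite weights_tor dg.
by move=> _ /diag_groupP[t ht ->]; rewrite dg weights_tor.
Qed.

Lemma std_torus_le s : std_torus s -> isometries_le B (m + m) s.
Proof.
move=> [t ht ->]; split; first exact: (tor_isometry unitB symB UW).
exact: rank_tor.
Qed.

End StandardTorus.

(** * Characters and weight decompositions *)

Section Characters.
Variables (K : closedFieldType) (d : nat).
Implicit Types (a b : 'rV[int]_d) (t : 'rV[K]_d).

(** The character of the diagonal torus with exponent vector a. *)
Definition chi a t := \prod_i t 0 i ^ a 0 i.

Lemma chiM a t t' : chi a (tmul t t') = chi a t * chi a t'.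
Proof.
rewrite /chi -big_split; apply: eq_bigr => i _.
by rewrite mxE expfzMl.
Qed.

Lemma chi1 a : chi a (const_mx 1) = 1.
Proof. by rewrite /chi big1 // => i _; rewrite mxE exp1rz. Qed.

Lemma chiD a b t : torus_pt t -> chi (a + b) t = chi a t * chi b t.
Proof.
move=> ht; rewrite /chi -big_split; apply: eq_bigr => i _.
by rewrite mxE expfzDr.
Qed.

Lemma chi0 t : chi 0 t = 1.
Proof. by rewrite /chi big1 // => i _; rewrite mxE expr0z. Qed.

Lemma chi_neq0 a t : torus_pt t -> chi a t != 0.
Proof. by move=> ht; apply/prodf_neq0 => i _; apply: expfz_neq0. Qed.

Lemma chiN a t : torus_pt t -> chi (- a) t = (chi a t)^-1.
Proof.
move=> ht; apply: (mulfI (chi_neq0 a ht)).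
by rewrite -chiD // subrr chi0 mulfV ?chi_neq0.
Qed.

Lemma chi_nontrivial a : a != 0 -> exists2 t, torus_pt t & chi a t != 1.
Proof.
move=> /rV0Pn[i ai].
have [z [z0 _ za]] := exists_expz_neq1 (nil : seq K) ai.
exists (\row_j if j == i then z else 1).
  by move=> j; rewrite mxE; case: ifP; rewrite ?oner_neq0.
rewrite /chi (bigD1 i) //= big1 => [|j ji]; first by rewrite mxE eqxx mulr1.
by rewrite mxE (negPf ji) exp1rz.
Qed.

Lemma chi_separate a b : a != b -> exists2 t, torus_pt t & chi a t != chi b t.
Proof.
rewrite -subr_eq0 => /chi_nontrivial[t ht h]; exists t => //.
apply: contraNneq h => E; rewrite chiD // chiN // E mulfV //; exact: chi_neq0.
Qed.

(** Artin's argument: translating by a point that separates two characters and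
    subtracting shortens the relation. *)
Lemma chi_independent n (l : seq 'rV[int]_d) (P : 'rV[int]_d -> 'M[K]_n) :
  uniq l -> (forall t, torus_pt t -> \sum_(a <- l) chi a t *: P a = 0) ->
  forall a, a \in l -> P a = 0.
Proof.
elim: l P => [//|a l IH] P /= /andP[al ul] H.
have Pl b : b \in l -> P b = 0.
  move=> bl; have /chi_separate[t0 ht0 hab] : b != a.
    by apply: contraNneq al => <-.
  pose Q c := (chi c t0 - chi a t0) *: P c.
  suff : Q b = 0.
    by move/eqP; rewrite scaler_eq0 subr_eq0 (negPf hab) /= => /eqP.
  apply: (IH Q) => // t ht.
  have := H _ (torus_pt_tmul ht0 ht); have := H _ ht; rewrite !big_cons => E1 E2.
  transitivity ((chi a (tmul t0 t) *: P a + \sum_(c <- l) chi c (tmul t0 t) *: P c)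
    - chi a t0 *: (chi a t *: P a + \sum_(c <- l) chi c t *: P c)); last first.
    by rewrite E1 E2 scaler0 subrr.
  rewrite scalerDr scalerA chiM opprD addrACA subrr add0r scaler_sumr -sumrB.
  apply: eq_bigr => c _; rewrite /Q !scalerA chiM -scalerBl; congr (_ *: _).
  by rewrite mulrBr mulrC [chi c t * _]mulrC.
have Pa : P a = 0.
  have := H (const_mx 1) (torus_pt_const (oner_neq0 K)); rewrite big_cons chi1 scale1r.
  rewrite big_seq big1 ?addr0 // => c cl; rewrite Pl ?scaler0 //.
by move=> b; rewrite inE => /orP[/eqP->|/Pl].
Qed.

(** Laurent polynomial functions, as finite sums of characters with possible
    repetitions. *)
Definition laurent (f : 'rV[K]_d -> K) := exists l : seq ('rV[int]_d * K),
  forall t, torus_pt t -> f t = \sum_(x <- l) chi x.1 t * x.2.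

Lemma laurent_ext f g : (forall t, torus_pt t -> f t = g t) -> laurent f -> laurent g.
Proof. by move=> fg [l lE]; exists l => t ht; rewrite -fg // lE. Qed.

Lemma laurent_chi a c : laurent (fun t => chi a t * c).
Proof. by exists [:: (a, c)] => t ht; rewrite big_seq1. Qed.

Lemma laurent_const c : laurent (fun=> c).
Proof. by apply: laurent_ext (laurent_chi 0 c) => t ht; rewrite chi0 mul1r. Qed.

Lemma laurentD f g : laurent f -> laurent g -> laurent (fun t => f t + g t).
Proof. by move=> [l lE] [k kE]; exists (l ++ k) => t ht; rewrite big_cat lE ?kE. Qed.

Lemma laurentM f g : laurent f -> laurent g -> laurent (fun t => f t * g t).
Proof.
move=> [l lE] [k kE].
exists [seq (x.1 + y.1, x.2 * y.2) | x <- l, y <- k] => t ht.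
rewrite big_allpairs_dep lE // kE // mulr_suml; apply: eq_bigr => x _.
by rewrite mulr_sumr; apply: eq_bigr => y _; rewrite chiD // mulrACA.
Qed.

Lemma laurent_sum I (r : seq I) (F : I -> 'rV[K]_d -> K) :
  (forall i, laurent (F i)) -> laurent (fun t => \sum_(i <- r) F i t).
Proof.
move=> hF; elim: r => [|i r IH].
  by apply: laurent_ext (laurent_const 0) => t _; rewrite big_nil.
by apply: laurent_ext (laurentD (hF i) IH) => t _; rewrite big_cons.
Qed.

Lemma laurent_prod I (r : seq I) (F : I -> 'rV[K]_d -> K) :
  (forall i, laurent (F i)) -> laurent (fun t => \prod_(i <- r) F i t).
Proof.
move=> hF; elim: r => [|i r IH].
  by apply: laurent_ext (laurent_const 1) => t _; rewrite big_nil.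
by apply: laurent_ext (laurentM (hF i) IH) => t _; rewrite big_cons.
Qed.

Lemma laurentX f k : laurent f -> laurent (fun t => f t ^+ k).
Proof.
move=> hf; elim: k => [|k IH]; first exact: laurent_const.
by apply: laurent_ext (laurentM hf IH) => t _; rewrite exprS.
Qed.

Lemma laurent_coordz i (k : int) : laurent (fun t => t 0 i ^ k).
Proof.
apply: laurent_ext (laurent_chi (\row_j if j == i then k else 0) 1) => t ht.
rewrite mulr1 /chi (bigD1 i) //= big1 => [|j ji]; first by rewrite mxE eqxx mulr1.
by rewrite mxE (negPf ji) expr0z.
Qed.

(** On diagonal matrices the entries are coordinates or zero, and the inverse of
    the determinant is a character. *)
Lemma regular_laurent f : regular_on (@diag_group K d) f ->
  laurent (fun t => f (diag_mx t)).
Proof.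
case=> p [k pE].
have hp : laurent (fun t => p.@[mxpt (diag_mx t)]).
  apply: (@laurent_ext (fun t =>
    \sum_(m <- msupp p) p@_m * \prod_i mxpt (diag_mx t) i ^+ m i)).
    by move=> t _; rewrite mevalE.
  apply: laurent_sum => m; apply: laurentM; first exact: laurent_const.
  apply: laurent_prod => l; apply: laurentX.
  case/mxvec_indexP: l => i j; rewrite /mxpt.
  have [<-|ij] := eqVneq i j.
    apply: laurent_ext (laurent_coordz i 1) => t _.
    by rewrite mxvecE mxE eqxx mulr1n.
  by apply: laurent_ext (laurent_const 0) => t _; rewrite mxvecE mxE (negPf ij).
have hd : laurent (fun t => (\det (diag_mx t))^-1 ^+ k).
  apply: laurentX; apply: laurent_ext (laurent_prod (index_enum _)
    (fun i => laurent_coordz i (-1))) => t ht.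
  by rewrite det_diag -prodfV; apply: eq_bigr => i _; rewrite exprN1.
apply: laurent_ext (laurentM hp hd) => t ht; rewrite pE ?exprVn //.
by apply/diag_groupP; exists t.
Qed.

(** The Laurent expansions of the entries, collected by exponent. *)
Lemma weight_decomposition n (g : 'M[K]_d -> 'M[K]_n) :
  (forall i j, regular_on (@diag_group K d) (fun s => g s i j)) ->
  exists (l : seq 'rV[int]_d) (P : 'rV[int]_d -> 'M[K]_n),
  [/\ uniq l, forall a, a \in l -> P a != 0
    & forall t, torus_pt t -> g (diag_mx t) = \sum_(a <- l) chi a t *: P a].
Proof.
move=> hg.
have /fin_all_exists[L LE] : forall ij : 'I_n * 'I_n, exists l : seq ('rV[int]_d * K),
    forall t, torus_pt t -> g (diag_mx t) ij.1 ij.2 = \sum_(x <- l) chi x.1 t * x.2.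
  by move=> [i j]; apply: (regular_laurent (hg i j)).
pose P a := \matrix_(i, j) \sum_(x <- L (i, j) | x.1 == a) x.2.
pose l0 := undup (flatten [seq [seq x.1 | x <- L ij] | ij <- enum {: 'I_n * 'I_n}]).
have gE t : torus_pt t -> g (diag_mx t) = \sum_(a <- l0) chi a t *: P a.
  move=> ht; apply/matrixP => i j; rewrite summxE (LE (i, j)) //=.
  transitivity (\sum_(a <- l0) \sum_(x <- L (i, j)) if x.1 == a then chi a t * x.2 else 0).
    rewrite exchange_big big_seq [RHS]big_seq; apply: eq_bigr => x xL.
    rewrite (bigD1_seq x.1) ?undup_uniq //=.
      by rewrite eqxx big1 ?addr0 // => a; rewrite eq_sym => /negPf->.
    rewrite mem_undup; apply/flattenP; exists [seq x.1 | x <- L (i, j)].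
      by apply: map_f; rewrite mem_enum.
    exact: map_f.
  by apply: eq_bigr => a _; rewrite !mxE mulr_sumr [RHS]big_mkcond.
exists [seq a <- l0 | P a != 0], P; split.
- by rewrite filter_uniq // undup_uniq.
- by move=> a; rewrite mem_filter => /andP[].
move=> t ht; rewrite gE // big_filter [RHS]big_mkcond; apply: eq_bigr => a _.
by case: eqP => //= ->; rewrite scaler0.
Qed.

End Characters.

(** If z_j^(det M) = y_j, the point with coordinates the products of the
    z_j^((adj M)_ij) is a solution because M times its adjugate is det M. *)
Lemma chi_surjective (K : closedFieldType) d (M : 'M[int]_d) (y : 'rV[K]_d) :
  \det M != 0 -> torus_pt y -> exists2 t, torus_pt t & forall i, chi (row i M) t = y 0 i.
Proof.
move=> dM hy.
have /fin_all_exists2[z z0 zE] : forall j, exists2 z : K, z != 0 & z ^ (\det M) = y 0 j.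
  by move=> j; apply: exists_root_expz.
exists (\row_i \prod_j z j ^ (\adj M i j)).
  by move=> i; rewrite mxE; apply/prodf_neq0 => j _; apply: expfz_neq0.
move=> r; rewrite /chi.
transitivity (\prod_j z j ^ (\sum_i M r i * \adj M i j)).
  transitivity (\prod_i \prod_j z j ^ (M r i * \adj M i j)).
    apply: eq_bigr => i _; rewrite [row r M 0 i]mxE [X in X ^ _]mxE.
    elim/big_rec2: _ => [|j x w _ <-]; first by rewrite exp1rz.
    by rewrite expfzMl exprz_exp mulrC [_ * M r i]mulrC mulrC.
  rewrite exchange_big; apply: eq_bigr => j _.
  by elim/big_rec2: _ => [|i x w _ ->]; rewrite ?expr0z // expfzDr.
have ME j : \sum_i M r i * \adj M i j = \det M *+ (r == j).
  by have /matrixP/(_ r j) := mul_mx_adj M; rewrite mxE => ->; rewrite mxE.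
rewrite (eq_bigr (fun j => z j ^ (\det M *+ (r == j)))) => [|j _]; last by rewrite ME.
rewrite (bigD1 r) //= big1 => [|j jr]; first by rewrite eqxx mulr1n zE mulr1.
by rewrite eq_sym (negPf jr) expr0z.
Qed.

(** * Maximal tori are standard *)

Section WeightSpaces.
Variables (K : closedFieldType) (n : nat) (B : 'M[K]_n) (eps : bool).
Hypothesis two_neq0 : 2%:R != 0 :> K.
Hypothesis unitB : B \in unitmx.
Hypothesis symB : B^T = (-1) ^+ eps *: B.
Local Notation tor := (torus_elt B eps).

Variables (d : nat) (G : 'rV[K]_d -> 'M[K]_n).
Variables (l : seq 'rV[int]_d) (P : 'rV[int]_d -> 'M[K]_n).
Hypothesis uniq_l : uniq l.
Hypothesis P_neq0 : forall a, a \in l -> P a != 0.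
Hypothesis GE : forall t, torus_pt t -> G t = \sum_(a <- l) chi a t *: P a.
Hypothesis GM : forall t t', torus_pt t -> torus_pt t' -> G (tmul t t') = G t *m G t'.
Hypothesis G_inj : forall t, torus_pt t -> G t = 1%:M -> t = const_mx 1.
Hypothesis G_iso : forall t, torus_pt t -> isometries B (G t).

Let nz1 : torus_pt (const_mx 1 : 'rV[K]_d) := torus_pt_const (oner_neq0 K).

Lemma tmul1 (t : 'rV[K]_d) : tmul (const_mx 1) t = t.
Proof. by apply/rowP => i; rewrite !mxE mul1r. Qed.

(** An idempotent invertible matrix is the identity. *)
Lemma param_one : G (const_mx 1) = 1%:M.
Proof.
have [u _] := G_iso nz1.
by apply: (can_inj (mulKmx u)); rewrite -GM // tmul1 mulmx1.
Qed.

Lemma sum_weight_comp : \sum_(a <- l) P a = 1%:M.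
Proof. by rewrite -param_one GE //; apply: eq_bigr => a _; rewrite chi1 scale1r. Qed.

(** Compare the expansions in t' of G(t t') and G(t) G(t') and use the independence
    of characters. *)
Lemma weight_comp t a : torus_pt t -> a \in l -> G t *m P a = chi a t *: P a.
Proof.
move=> ht al; apply/eqP; rewrite -subr_eq0; apply/eqP.
apply: (chi_independent (P := fun b => G t *m P b - chi b t *: P b) uniq_l) => // t' ht'.
transitivity (G t *m G t' - G (tmul t t')); last by rewrite GM // subrr.
rewrite (GE ht') (GE (torus_pt_tmul ht ht')) mulmx_sumr -sumrB; apply: eq_bigr => b _.
by rewrite scalerBr scalemxAr scalerA chiM mulrC.
Qed.

(** The form is invariant, while the torus multiplies it by the character a + b
    on these two components. *)
Lemma weight_comp_orth a b : a \in l -> b \in l -> a + b != 0 ->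
  (P a)^T *m B *m P b = 0.
Proof.
move=> al bl /(@chi_nontrivial K)[t ht h]; apply/eqP.
have : (G t *m P a)^T *m B *m (G t *m P b) = (P a)^T *m B *m P b.
  by rewrite trmx_mul -!mulmxA (mulmxA _^T B) (mulmxA _ (G t)) (G_iso ht).2 mulmxA.
rewrite !weight_comp // [(_ *: _)^T]linearZ /= -!scalemxAl -scalemxAr scalerA -chiD //.
move/eqP; rewrite -subr_eq0 -[X in _ - X]scale1r -scalerBl scaler_eq0 subr_eq0.
by rewrite (negPf h).
Qed.

(** An integer vector w orthogonal to all the weights defines a one-parameter
    subgroup z |-> (z^(w_i)) on which G is trivial, so that w = 0 by injectivity.
    A rational vector is reduced to an integral one by clearing denominators. *)
Lemma weights_row_full :
  row_full (\matrix_(r < size l, i < d) ((l`_r : 'rV[int]_d) 0 i)%:~R : 'M[rat]_(_, _)).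
Proof.
set A := (X in row_full X).
rewrite /row_full -mxrank_tr -/(row_free A^T) -kermx_eq0; apply/negPn/negP => /rowV0Pn[v].
move/sub_kermxP => vA v0.
(* The vector v multiplied by the product of its denominators. *)
pose w i : int := numq (v 0 i) * \prod_(j | j != i) denq (v 0 j).
pose D : int := \prod_j denq (v 0 j).
have wE i : (w i)%:~R = D%:~R * v 0 i :> rat.
  by rewrite /w /D [in RHS](bigD1 i) //= !rmorphM /= numqE; ring.
have D0 : D%:~R != 0 :> rat.
  by rewrite intr_eq0; apply/prodf_neq0 => j _; rewrite denq_eq0.
have /rV0Pn[i vi] := v0.
have wi : w i != 0 by rewrite -(intr_eq0 rat) wE mulf_neq0.
have [z [z0 _ zw]] := exists_expz_neq1 (nil : seq K) wi.
pose t := \row_j z ^ w j : 'rV[K]_d.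
have ht : torus_pt t by move=> j; rewrite mxE expfz_neq0.
have tE : forall a, a \in l -> chi a t = 1.
  move=> a /(nthP 0)[r rl <-]; rewrite /chi.
  have E : \sum_j w j * (l`_r : 'rV_d) 0 j = 0.
    apply/eqP; rewrite -(intr_eq0 rat) rmorph_sum /=.
    apply/eqP; transitivity (D%:~R * (v *m A^T) 0 (Ordinal rl)); last first.
      by rewrite vA mxE mulr0.
    rewrite mxE mulr_sumr; apply: eq_bigr => j _.
    by rewrite !mxE intrM wE mulrA.
  transitivity (z ^ (\sum_j w j * (l`_r : 'rV_d) 0 j)); last by rewrite E expr0z.
  elim/big_rec2: _ => [|j x y _ ->]; first by rewrite expr0z.
  by rewrite mxE exprz_exp expfzDr.
have : t = const_mx 1.
  apply: G_inj => //; rewrite GE // -sum_weight_comp [LHS]big_seq [RHS]big_seq.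
  by apply: eq_bigr => a al; rewrite tE // scale1r.
by move=> /rowP/(_ i); rewrite !mxE => /eqP; rewrite (negPf zw).
Qed.

Lemma exists_weight_basis : exists2 M : 'M[int]_d, \det M != 0 & forall i, row i M \in l.
Proof.
have h := weights_row_full; set A := (X in row_full X) in h.
pose k := fullrankfun h; exists (\matrix_(i, j) (l`_(k i) : 'rV[int]_d) 0 j).
  have := fullrowsub_unit h; rewrite unitmxE unitfE.
  have -> : rowsub k A = map_mx intr (\matrix_(i, j) (l`_(k i) : 'rV[int]_d) 0 j).
    by apply/matrixP => i j; rewrite !mxE.
  by rewrite det_map_mx intr_eq0.
move=> i; have -> : row i (\matrix_(i, j) (l`_(k i) : 'rV[int]_d) 0 j) = l`_(k i).
  by apply/rowP => j; rewrite !mxE.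
exact: mem_nth.
Qed.

(** Take u_i in the component of the i-th weight of a basis M; its dual vector may
    be chosen in the component of the opposite weight, the only one that is not
    orthogonal to u_i. *)
Lemma weight_hyperbolic : exists (M : 'M[int]_d) (U W : 'M[K]_(n, d)),
  [/\ \det M != 0, hyperbolic B U W
    & forall t, torus_pt t -> let s := \row_i chi (row i M) t in
        G t *m U = U *m diag_mx s /\ G t *m W = W *m diag_mx (tinv s)].
Proof.
have [M dM Ml] := exists_weight_basis.
(* By surjectivity, the weights of the basis take independent values, so that
   the weights +-a_i are pairwise distinct. *)
have sumW i j : row i M + row j M != 0.
  have [z [z0 _ z1]] := exists_expz_neq1 (nil : seq K) (isT : (2%:Z != 0)).
  have [t ht tE] := chi_surjective dM (torus_pt_const (m := d) z0).
  apply: contraNneq z1 => E; have := chi0 t; rewrite -E chiD // !tE !mxE.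
  by move=> h; rewrite -exprnP expr2 h.
have difW i j : i != j -> row i M - row j M != 0.
  move=> ij; have [z [z0 _ z1]] := exists_expz_neq1 (nil : seq K) (isT : (1%:Z != 0)).
  have [t ht tE] := @chi_surjective _ _ _ (\row_k if k == i then z else 1) dM
    ltac:(by move=> k; rewrite mxE; case: ifP; rewrite ?oner_neq0).
  apply: contraNneq z1 => E; have := chi0 t; rewrite -E chiD // chiN // !tE !mxE.
  by rewrite eqxx eq_sym (negPf ij) invr1 mulr1 expr1z => ->.
have /fin_all_exists[uw uwE] i : exists uw : 'cV[K]_n * 'cV[K]_n,
    [/\ exists x, uw.1 = P (row i M) *m x,
        - row i M \in l /\ exists x, uw.2 = P (- row i M) *m x
      & uw.1^T *m B *m uw.2 = 1%:M].
  have [j uj] := exists_col_neq0 (P_neq0 (Ml i)).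
  set u := col j _ in uj.
  have [x xE] : exists x, u = P (row i M) *m x by rewrite /u colE; eexists.
  have [y uy] := exists_dual unitB uj.
  have uP b : b \in l -> b != - row i M -> u^T *m B *m P b = 0.
    move=> bl hb; rewrite xE trmx_mul -!mulmxA (mulmxA (P _)^T) weight_comp_orth ?mulmx0 //.
    by rewrite addrC -[row i M]opprK subr_eq0.
  have uyE : u^T *m B *m y = \sum_(b <- l) u^T *m B *m P b *m y.
    by rewrite -mulmx_suml -mulmx_sumr sum_weight_comp mulmx1.
  have Nl : - row i M \in l.
    apply/negPn/negP => Nl; move: uyE; rewrite uy big_seq big1 => [|b bl].
      by apply/eqP; rewrite oner_eq0.
    by rewrite uP ?mul0mx //; apply: contraNneq Nl => <-.
  exists (u, P (- row i M) *m y); split=> /=; first by exists x.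
    by split=> //; exists y.
  rewrite -uy uyE (bigD1_seq (- row i M)) //= big_seq_cond big1 ?addr0 ?mulmxA //.
  by move=> b /andP[bl hb]; rewrite uP ?mul0mx.
pose U := \matrix_(r, i) (uw i).1 r 0; pose W := \matrix_(r, i) (uw i).2 r 0.
have cU i : col i U = (uw i).1 by apply/matrixP => r c; rewrite !mxE ord1.
have cW i : col i W = (uw i).2 by apply/matrixP => r c; rewrite !mxE ord1.
have orth0 (a b : 'rV[int]_d) (x y : 'cV[K]_n) : a \in l -> b \in l -> a + b != 0 ->
    (P a *m x)^T *m B *m (P b *m y) = 0.
  move=> al bl ab; rewrite trmx_mul -!mulmxA (mulmxA B) (mulmxA (P a)^T).
  by rewrite (mulmxA (P a)^T B) weight_comp_orth // mul0mx mulmx0.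
exists M, U, W; split=> //.
- split; apply/matrixP => i j; rewrite (form_cols B) ?cU ?cW.
  + have [[x ->] _ _] := uwE i; have [[y ->] _ _] := uwE j.
    by rewrite orth0 ?mxE.
  + have [_ [hi [x ->]] _] := uwE i; have [_ [hj [y ->]] _] := uwE j.
    by rewrite orth0 ?mxE // -opprD oppr_eq0.
  have [<-|ij] := eqVneq i j.
    by have [_ _ ->] := uwE i; rewrite !mxE !eqxx.
  have [[x ->] _ _] := uwE i; have [_ [hj [y ->]] _] := uwE j.
  by rewrite orth0 ?mxE ?(negPf ij) // difW.
move=> t ht s; split; apply: mul_diag_cols => i; rewrite ?cU ?cW.
  by have [[x ->] _ _] := uwE i; rewrite mulmxA weight_comp // -scalemxAl mxE.
have [_ [hi [x ->]] _] := uwE i.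
by rewrite mulmxA weight_comp // -scalemxAl !mxE chiN.
Qed.

(** When no weight is 1 the element is recognised by its eigenvalues and its rank;
    in general it is the quotient of two such elements. *)
Lemma torus_standard m : (m <= d)%N ->
  (forall t, torus_pt t -> (\rank (G t - 1%:M)%R <= m + m)%N) ->
  exists U W : 'M[K]_(n, m), hyperbolic B U W /\
    forall s, (exists2 t, torus_pt t & s = G t) <-> (exists2 t, torus_pt t & s = tor U W t).
Proof.
move=> md Gm; have [M [U [W [dM UW GUW]]]] := weight_hyperbolic.
have XG := (hyperbolic_frame symB U W).1 UW.
have dm : (d + d <= m + m)%N.
  have [z] := exists_notin [:: 0; 1 : K]; rewrite !inE negb_or => /andP[z0 z1].
  have [t ht tE] := chi_surjective dM (torus_pt_const (m := d) z0).
  apply: leq_trans (Gm t ht).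
  have sE : \row_i chi (row i M) t = const_mx z by apply/rowP => i; rewrite mxE tE.
  have := GUW t ht; rewrite /= sE => -[hU hW].
  have uD : torus_block (const_mx z : 'rV[K]_d) - 1%:M \in unitmx.
    by apply: torus_block_sub1_unit => [|i]; [exact: torus_pt_const|rewrite mxE].
  apply: (rank_sub1_ge XG) uD.
  by rewrite mul_mx_row mul_row_block !mulmx0 addr0 add0r hU hW.
have {}dm : d = m by apply/eqP; rewrite eqn_leq md andbT -leq_double -!addnn.
have {}Gm t : torus_pt t -> (\rank (G t - 1%:M)%R <= d + d)%N.
  by move=> ht; have := Gm t ht; rewrite -dm.
rewrite -dm; exists U, W; split=> //.
have gen t : torus_pt t -> (forall i, chi (row i M) t != 1) ->
    G t = tor U W (\row_i chi (row i M) t).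
  move=> ht h1; have [hU hW] := GUW t ht.
  apply: (tor_recognize symB UW (G_iso ht)) => //; last exact: Gm.
    by move=> i; rewrite mxE chi_neq0.
  by move=> i; rewrite mxE.
(* Choose t0 such that no weight is 1 at t0 or at t t0. *)
have all t : torus_pt t -> G t = tor U W (\row_i chi (row i M) t).
  move=> ht.
  have /fin_all_exists[y yE] i : exists y, y \notin [:: 0; 1; (chi (row i M) t)^-1].
    exact: exists_notin.
  have hy : torus_pt (\row_i y i).
    by move=> i; rewrite mxE; have := yE i; rewrite !inE negb_or => /andP[].
  have [t0 ht0 t0E] := chi_surjective dM hy.
  have h0 : G t0 = tor U W (\row_i y i).
    rewrite gen //; first by congr tor; apply/rowP => i; rewrite mxE t0E.
    by move=> i; rewrite t0E mxE; have := yE i; rewrite !inE !negb_or => /and3P[].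
  have [u0 _] := tor_isometry unitB symB UW hy.
  apply: (can_inj (mulmxK u0)); rewrite -{1}h0 -GM // (torM symB UW) gen.
  - by congr tor; apply/rowP => i; rewrite !mxE chiM t0E mxE.
  - exact: torus_pt_tmul.
  move=> i; rewrite chiM t0E mxE; have := yE i; rewrite !inE !negb_or => /and3P[_ _ h].
  apply: contraNneq h => h; have c0 := chi_neq0 (row i M) ht.
  by apply/eqP; apply: (mulfI c0); rewrite h mulfV.
move=> s; split=> [[t ht ->]|[y hy ->]].
  exists (\row_i chi (row i M) t); last exact: all.
  by move=> i; rewrite mxE chi_neq0.
have [t ht tE] := chi_surjective dM hy; exists t => //; rewrite all //.
by congr tor; apply/rowP => i; rewrite mxE tE.
Qed.

End WeightSpaces.

Section MaximalTori.
Variables (K : closedFieldType) (n : nat) (B : 'M[K]_n) (eps : bool).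
Hypothesis two_neq0 : 2%:R != 0 :> K.
Hypothesis unitB : B \in unitmx.
Hypothesis symB : B^T = (-1) ^+ eps *: B.

Lemma maximal_torus_standard m (S : 'M[K]_n -> Prop) d : (m + m <= n)%N ->
  is_torus S d -> (forall s, S s -> isometries_le B (m + m) s) ->
  (forall S' d', is_torus S' d' -> (forall s, S' s -> isometries_le B (m + m) s) ->
     (d' <= d)%N) ->
  exists U W : 'M[K]_(n, m), hyperbolic B U W /\
    forall s, S s <-> std_torus B eps U W s.
Proof.
move=> mn [[S1 SM SV _] [f [g [fm gm fgK gfK]]]] Sle Smax.
have [U0 [W0 UW0]] := exists_hyperbolic two_neq0 unitB symB mn.
have md : (m <= d)%N.
  apply: Smax (std_torus_is_torus unitB symB UW0) _.
  by move=> s; apply: std_torus_le.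
have [l [P [ul P0 gE]]] := weight_decomposition (let: And3 _ _ h := gm in h).
have dg t : torus_pt t -> diag_group (diag_mx t : 'M[K]_d).
  by move=> ht; apply/diag_groupP; exists t.
have [gS gM _] := gm; have [fT fM _] := fm.
have gM' t t' : torus_pt t -> torus_pt t' ->
    g (diag_mx (tmul t t')) = g (diag_mx t) *m g (diag_mx t').
  by move=> ht ht'; rewrite diag_tmul gM //; apply: dg.
have giso t : torus_pt t -> isometries B (g (diag_mx t)).
  by move=> ht; case: (Sle _ (gS _ (dg _ ht))).
have ginj t : torus_pt t -> g (diag_mx t) = 1%:M -> t = const_mx 1.
  move=> ht g1; have dt := gfK _ (dg _ ht); rewrite g1 in dt.
  have h1 := param_one gM' giso; have d1 := gfK _ (dg _ (torus_pt_const (oner_neq0 K))).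
  rewrite h1 dt in d1; apply/rowP => i; move/matrixP/(_ i i): d1.
  by rewrite !mxE eqxx !mulr1n.
have [|U [W [UW SE]]] := torus_standard unitB symB ul P0 gE gM' ginj giso md.
  by move=> t ht; case: (Sle _ (gS _ (dg _ ht))).
exists U, W; split=> // s; rewrite -[std_torus _ _ _ _ _]SE; split=> [Ss|[t ht ->]].
  have /diag_groupP[t ht tE] := fT _ Ss; exists t => //.
  by rewrite -tE fgK.
by apply: gS; apply: dg.
Qed.

End MaximalTori.

(** * Roots and the regular part *)

Section TangentVectors.
Variables (K : closedFieldType) (n : nat).

Lemma lie_algebra_linear_coef (G : 'M[K]_n -> Prop) A f (q : {poly K}) :
  lie_algebra G A -> polyfun f -> (forall s, G s -> f s = 0) ->
  (forall z, f (1%:M + z *: A) = q.[z]) -> q`_1 = 0.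
Proof.
move=> GA [p pE] f0 fq; have [r rE r1] := mderiv_line p 1%:M A.
have -> : q = r.
  by apply: (@poly_eq_off _ _ _ [::]) => z _; rewrite -fq pE rE.
by rewrite r1 GA // => s Gs; rewrite -pE f0.
Qed.

(** A whole line in G through 1 is tangent to G. *)
Lemma line_lie_algebra (G : 'M[K]_n -> Prop) A :
  (forall z, G (1%:M + z *: A)) -> lie_algebra G A.
Proof.
move=> GA p pG; have [r rE <-] := mderiv_line p 1%:M A.
suff -> : r = 0 by rewrite coef0.
by apply: poly_zero_all => z; rewrite rE; apply: pG.
Qed.

Variables (B : 'M[K]_n) (E : 'cV[K]_n -> Prop) (A : 'M[K]_n).
Hypothesis lieA : lie_algebra (pointwise_fixer B E) A.

(** The linear coefficient of h^T B h - B along 1 + z A. *)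
Lemma lie_fixer_skew : A^T *m B + B *m A = 0.
Proof.
apply/matrixP => i j; rewrite [RHS]mxE.
pose f (h : 'M[K]_n) := (h^T *m B *m h - B) i j.
pose q := ((A^T *m B + B *m A) i j)%:P * 'X + ((A^T *m B *m A) i j)%:P * 'X^2.
have <- : q`_1 = (A^T *m B + B *m A) i j.
  by rewrite /q coefD !coefCM coefX coefXn mulr1 mulr0 addr0.
apply: (lie_algebra_linear_coef (f := f) lieA).
- have h : polymx (fun h : 'M[K]_n => h^T *m B *m h - B) by polymx_tac.
  exact: h.
- by move=> s [[_ sB] _]; rewrite /f sB subrr mxE.
move=> z; rewrite /f /q !hornerE.
have -> : (1%:M + z *: A)^T *m B *m (1%:M + z *: A) - B
   = z *: (A^T *m B + B *m A) + z ^+ 2 *: (A^T *m B *m A).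
  rewrite [(_ + _)^T]linearD /= [(_ *: _)^T]linearZ /= trmx1 !mulmxDl !mulmxDr !mul1mx !mulmx1.
  rewrite -!scalemxAl -!scalemxAr scalerA -expr2 scalerDr.
  by rewrite -!addrA addrC -!addrA addNr addr0 addrCA addrA.
move: (A^T *m B + B *m A) (A^T *m B *m A) => P Q; rewrite !mxE /=; ring.
Qed.

Lemma lie_fixer_kills v : E v -> A *m v = 0.
Proof.
move=> Ev; apply/matrixP => i j; rewrite [RHS]mxE.
pose f (h : 'M[K]_n) := (h *m v - v) i j.
pose q := ((A *m v) i j)%:P * 'X.
have <- : q`_1 = (A *m v) i j by rewrite /q coefCM coefX mulr1.
apply: (lie_algebra_linear_coef (f := f) lieA).
- have h : polymx (fun h : 'M[K]_n => h *m v - v) by polymx_tac.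
  exact: h.
- by move=> s [_ sE]; rewrite /f sE // subrr mxE.
move=> z; rewrite /f /q !hornerE mulmxDl mul1mx addrC addKr -scalemxAl mxE mulrC //.
Qed.

End TangentVectors.

Section RegularPart.
Variables (K : closedFieldType) (n : nat) (B : 'M[K]_n) (eps : bool).
Hypothesis two_neq0 : 2%:R != 0 :> K.
Hypothesis unitB : B \in unitmx.
Hypothesis symB : B^T = (-1) ^+ eps *: B.
Variables (m : nat) (U W : 'M[K]_(n, m)).
Hypothesis UW : hyperbolic B U W.

Local Notation e := ((-1) ^+ eps : K).
Local Notation tor := (torus_elt B eps U W).
Local Notation T := (std_torus B eps U W).
Local Notation X := (row_mx U W).
Local Notation Y := (coords B (row_mx U W) (hyperbolic_gram K eps m)).
Let XG := (hyperbolic_frame symB U W).1 UW.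

(** The complement of the kernels of the roots and of the locus where an
    eigenvalue on the moving part is 1. *)
Definition regular (t : 'rV[K]_m) :=
  [/\ torus_pt t, forall i, t 0 i != 1,
      forall i j, i != j -> t 0 i != t 0 j /\ t 0 i * t 0 j != 1
    & eps -> forall i, t 0 i * t 0 i != 1].

Lemma exists_neq01 : exists z : K, z != 0 /\ z != 1.
Proof. by have [z] := exists_notin [:: 0; 1 : K]; rewrite !inE negb_or => /andP[]; exists z. Qed.

Lemma fixed_torus v : fixed_space T v <-> X^T *m B *m v = 0.
Proof.
split=> [h|h _ [t ht ->]]; last exact: (frame_map_orth XG).
have [z [z0 z1]] := exists_neq01.
have ht : torus_pt (const_mx z : 'rV[K]_m) by apply: torus_pt_const.
have uD : torus_block (const_mx z : 'rV[K]_m) - 1%:M \in unitmx.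
  by apply: torus_block_sub1_unit => // i; rewrite mxE.
have := h _ (ex_intro2 _ _ _ ht erefl).
rewrite /torus_elt /frame_map mulmxDl mul1mx -[RHS]addr0 => /addrI E.
apply/(coords_eq0 _ XG); apply: (can_inj (mulKmx uD)); rewrite mulmx0.
by have := congr1 (mulmx Y) E; rewrite mulmx0 !mulmxA (coordsK XG) mul1mx.
Qed.

Lemma fixed_proj s (w : 'M[K]_(n, s)) : X^T *m B *m ((1%:M - X *m Y) *m w) = 0.
Proof.
apply/(coords_eq0 _ XG); rewrite mulmxA mulmxBr mulmx1 mulmxA (coordsK XG).
by rewrite mul1mx subrr mul0mx.
Qed.

Lemma proj_adj : (X *m Y)^T *m B = B *m (X *m Y).
Proof.
by rewrite trmx_mul -mulmxA (form_coords XG) !mulmxA (form_coordsT symB XG).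
Qed.

Lemma orth_fixed_torus v : orth B (fixed_space T) v <-> v = X *m Y *m v.
Proof.
split=> [h|-> w /fixed_torus Xw]; last first.
  by rewrite !mulmxA (form_sym0 symB Xw) !mul0mx.
apply/eqP; rewrite -subr_eq0 -{1}(mul1mx v) -mulmxBl; apply/eqP.
have Qv : (1%:M - X *m Y)^T *m B *m v = 0.
  apply/matrixP => i j; rewrite (form_cols B) [RHS]mxE.
  have -> : col j v = v by apply/colP => k; rewrite mxE ord1.
  by rewrite colE h ?mxE //; apply/fixed_torus; apply: fixed_proj.
apply: (can_inj (mulKmx unitB)); rewrite mulmx0 mulmxA mulmxBr mulmx1 -proj_adj -Qv.
by rewrite [(1%:M - _)^T]linearB /= trmx1; congr (_ *m _); rewrite mulmxBl mul1mx.
Qed.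

Lemma regular_invertible t : torus_pt t -> (forall i, t 0 i != 1) ->
  invertible_on (orth B (fixed_space T)) (tor t - 1%:M).
Proof.
move=> ht h1; have uD := torus_block_sub1_unit ht h1.
have gE : tor t - 1%:M = X *m (torus_block t - 1%:M) *m Y.
  by rewrite /torus_elt /frame_map addrC addKr.
have VX s (v : 'M[K]_(_, s)) : X *m Y *m (X *m v) = X *m v.
  by rewrite -mulmxA (mulmxA Y) (coordsK XG) mul1mx.
split=> [v _|v /orth_fixed_torus vE].
  by apply/orth_fixed_torus; rewrite gE -[_ *m v]mulmxA -(mulmxA X (_ - _)) VX.
exists (X *m (invmx (torus_block t - 1%:M) *m (Y *m v))); split.
  split; first by apply/orth_fixed_torus; rewrite VX.
  rewrite gE -!mulmxA (mulmxA Y X) (coordsK XG) mul1mx (mulmxA (torus_block t - _)).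
  by rewrite mulmxV // mul1mx [RHS]vE mulmxA.
move=> w [/orth_fixed_torus wE <-].
rewrite gE -!mulmxA (mulmxA Y X) (coordsK XG) mul1mx (mulmxA (invmx _)) mulVmx //.
by rewrite mul1mx [RHS]wE mulmxA.
Qed.

(** If t_i = 1 then u_i is a nonzero vector of the moving part fixed by the element. *)
Lemma invertible_regular t i : invertible_on (orth B (fixed_space T)) (tor t - 1%:M) ->
  t 0 i != 1.
Proof.
move=> [_ h]; apply/eqP => ti.
have V0 : orth B (fixed_space T) 0 by move=> w _; rewrite mulmx0.
have [w [_ uw]] := h _ V0.
have w0 : w = 0 by apply: uw; split=> //; rewrite mulmx0.
have XY : X *m Y *m X = X by rewrite -mulmxA (coordsK XG) mulmx1.
have wU : w = col i U.
  apply: uw; split; last first.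
    by rewrite mulmxBl mul1mx colE mulmxA (tor_U symB UW) -!colE col_mul_diag ti scale1r subrr.
  apply/orth_fixed_torus; rewrite colE mulmxA; congr (_ *m _).
  by move: XY; rewrite mul_mx_row => /eq_row_mx[].
have : (U^T *m B *m W) i i = 0.
  by rewrite (form_cols B) -wU w0 trmx0 !mul0mx mxE.
by case: UW => _ _ ->; rewrite mxE eqxx => /eqP; rewrite oner_eq0.
Qed.

(** The matrix A = a b^T B -+ b a^T B is skew for the form and has square zero,
    so the line 1 + z A consists of isometries, which moreover fix what S fixes;
    and conjugation by s multiplies A by the product of the weights of a and b.
    The vector y witnesses A <> 0. *)
Lemma root_vector (a b : 'cV[K]_n) (wa wb : 'M[K]_n -> K) (y : 'cV[K]_n) :
  polyfun wa -> polyfun wb ->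
  (forall s, T s -> s *m a = wa s *: a) -> (forall s, T s -> s *m b = wb s *: b) ->
  a != 0 -> b != 0 ->
  a^T *m B *m a = 0 -> a^T *m B *m b = 0 -> b^T *m B *m b = 0 ->
  (forall v, fixed_space T v -> a^T *m B *m v = 0 /\ b^T *m B *m v = 0) ->
  a *m (b^T *m B *m y) - e *: (b *m (a^T *m B *m y)) != 0 ->
  (exists2 s, T s & wa s * wb s != 1) ->
  is_root (pointwise_fixer B (fixed_space T)) T (fun s => wa s * wb s).
Proof.
move=> pa pb sa sb a0 b0 aa ab bb fa Ay h1.
have w_mult (c : 'cV[K]_n) wc : c != 0 -> (forall s, T s -> s *m c = wc s *: c) ->
    (forall s, T s -> wc s != 0) /\
    forall s s', T s -> T s' -> wc (s *m s') = wc s * wc s'.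
  move=> c0 sc; split=> [s Ts|s s' Ts Ts'].
    have [t ht sE] := Ts; have [us _] := tor_isometry unitB symB UW ht.
    apply: contraNneq c0 => ws; have := sc _ Ts; rewrite ws scale0r => E.
    by rewrite -(mulKmx us c) -sE E mulmx0.
  have [_ TM _ _] := std_torus_closed_subgroup unitB symB UW.
  apply/eqP; rewrite -subr_eq0; have : (wc (s *m s') - wc s * wc s') *: c = 0.
    rewrite scalerBl -(sc _ (TM _ _ Ts Ts')) -mulmxA (sc _ Ts') -scalemxAr (sc _ Ts).
    by rewrite scalerA [wc s' * _]mulrC subrr.
  by move/eqP; rewrite scaler_eq0 (negPf c0) orbF.
have [wa0 waM] := w_mult a wa a0 sa; have [wb0 wbM] := w_mult b wb b0 sb.
split=> //.
  split; first by apply: polyfun_regular; apply: polyfunM.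
    by move=> s Ts; rewrite mulf_neq0 ?wa0 ?wb0.
  by move=> s s' Ts Ts'; rewrite waM // wbM // mulrACA.
pose A := a *m (b^T *m B) - e *: (b *m (a^T *m B)).
have ba := form_sym0 symB ab.
have AT : A^T *m B + B *m A = 0.
  rewrite /A [(_ - _)^T]linearB /= [(_ *: _)^T]linearZ /= !trmx_mul !trmxK symB.
  rewrite mulmxBl mulmxBr -!scalemxAl -!scalemxAr scalerA sgn_mulK scale1r.
  by rewrite !mulmxA addrA subrK subrr.
have AA : A *m A = 0.
  have xA (c : 'cV[K]_n) : c^T *m B *m a = 0 -> c^T *m B *m b = 0 -> c^T *m B *m A = 0.
    move=> ca cb; rewrite /A mulmxBr -scalemxAr [_ *m (a *m _)]mulmxA ca.
    by rewrite [_ *m (b *m _)]mulmxA cb !mul0mx scaler0 subrr.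
  rewrite {1}/A mulmxBl -scalemxAl -[a *m _ *m _]mulmxA -[b *m _ *m _]mulmxA.
  by rewrite !xA // !mulmx0 scaler0 subrr.
exists A; split.
- apply: line_lie_algebra => z; split; last first.
    move=> v /fa[av bv]; rewrite mulmxDl mul1mx -scalemxAl /A mulmxBl -scalemxAl.
    by rewrite -!mulmxA !(mulmxA _^T) av bv !mulmx0 scaler0 subrr scaler0 addr0.
  apply: isometriesP => //.
  rewrite [(_ + _)^T]linearD /= [(_ *: _)^T]linearZ /= trmx1 !mulmxDl !mulmxDr !mul1mx !mulmx1.
  rewrite -!scalemxAl -!scalemxAr.
  have -> : A^T *m B = - (B *m A) by apply/eqP; rewrite -addr_eq0 AT.
  by rewrite mulNmx -mulmxA AA mulmx0 oppr0 !scaler0 addr0 scalerN addrK.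
- apply: contraNneq Ay => A0; have : A *m y = 0 by rewrite A0 mul0mx.
  by rewrite /A mulmxBl -scalemxAl -!mulmxA => ->.
move=> s Ts; have [t ht sE] := Ts; have hs := tor_isometry unitB symB UW ht.
rewrite -sE in hs; have [us Bs] := hs.
have inv (c : 'cV[K]_n) wc : s *m c = wc *: c -> c^T *m B *m invmx s = wc *: (c^T *m B).
  move=> sc; apply: (can_inj (mulmxK us)); rewrite mulmxKV //.
  rewrite [wc *: _]scalemxAl.
  have -> : wc *: c^T = (s *m c)^T by rewrite sc linearZ.
  by rewrite trmx_mul -!mulmxA (mulmxA s^T) Bs.
have conj2 (c c' : 'cV[K]_n) wc wc' : s *m c = wc *: c -> s *m c' = wc' *: c' ->
    s *m (c *m (c'^T *m B)) *m invmx s = (wc * wc') *: (c *m (c'^T *m B)).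
  move=> sc sc'; rewrite mulmxA sc -mulmxA (inv _ _ sc') -scalemxAl -scalemxAr.
  by rewrite scalerA.
rewrite /A mulmxBr mulmxBl -scalemxAr -scalemxAl.
rewrite (conj2 _ _ _ _ (sa _ Ts) (sb _ Ts)) (conj2 _ _ _ _ (sb _ Ts) (sa _ Ts)).
by rewrite scalerBr !scalerA; congr (_ - _ *: _); ring.
Qed.

Local Notation wU := (weights B eps U W).
Local Notation wW := (inv_weights B U W).

Lemma torus_colU s i : T s -> s *m col i U = wU s 0 i *: col i U.
Proof.
move=> [t ht ->]; rewrite (weights_tor symB UW).
by rewrite colE mulmxA (tor_U symB UW) -!colE col_mul_diag.
Qed.

Lemma torus_colW s i : T s -> s *m col i W = wW s 0 i *: col i W.
Proof.
move=> [t ht ->]; rewrite (inv_weights_tor symB UW).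
by rewrite colE mulmxA (tor_W symB UW) -!colE col_mul_diag.
Qed.

Lemma form_col_mx r s (V : 'M[K]_(n, r)) (V' : 'M[K]_(n, s)) i j :
  (col i V)^T *m B *m col j V' = ((V^T *m B *m V') i j)%:M.
Proof. by rewrite (form_cols B) -mx11_scalar. Qed.

Lemma col_hyperbolic_fixed v i : fixed_space T v ->
  (col i U)^T *m B *m v = 0 /\ (col i W)^T *m B *m v = 0.
Proof.
move=> /fixed_torus; rewrite tr_row_mx !mul_col_mx -col_mx0 => /eq_col_mx[Uv Wv].
by split; rewrite colE trmx_mul -!mulmxA (mulmxA _^T B) ?Uv ?Wv mulmx0.
Qed.

Lemma col_hyperbolic_neq0 i : col i U != 0 /\ col i W != 0.
Proof.
have h : (col i U)^T *m B *m col i W != 0.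
  case: UW => _ _ UW1; rewrite form_col_mx UW1 mxE eqxx.
  by apply/eqP => /matrixP/(_ 0 0); rewrite !mxE eqxx => /eqP; rewrite oner_eq0.
by split; apply: contraNneq h => ->; rewrite ?trmx0 ?mul0mx ?mulmx0.
Qed.

Lemma torus_coord i (z : K) : z != 0 -> exists2 s, T s & forall j,
  wU s 0 j = (if j == i then z else 1) /\ wW s 0 j = (if j == i then z^-1 else 1).
Proof.
move=> z0; pose t : 'rV[K]_m := \row_j if j == i then z else 1.
have ht : torus_pt t by move=> j; rewrite mxE; case: ifP; rewrite ?oner_neq0.
exists (tor t); first by exists t.
move=> j; rewrite (weights_tor symB UW) (inv_weights_tor symB UW) !mxE.
by case: ifP; rewrite ?invr1.
Qed.

Lemma scalar_mx11_eq0 (c : K) : ((c%:M : 'M_1) == 0) = (c == 0).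
Proof.
apply/eqP/eqP => [/matrixP/(_ 0 0)|->]; last by rewrite raddf0.
by rewrite !mxE eqxx mulr1n.
Qed.

(** The pairs (u_i, w_j), (u_i, u_j) for i <> j, and (u_i, u_i) in the symplectic
    case, give root vectors. *)
Lemma regular_of_roots t : torus_pt t ->
  (forall alpha, is_root (pointwise_fixer B (fixed_space T)) T alpha ->
     alpha (tor t) != 1) ->
  (forall i j, i != j -> t 0 i != t 0 j /\ t 0 i * t 0 j != 1) /\
  (eps -> forall i, t 0 i * t 0 i != 1).
Proof.
move=> ht hroot; have [UU WW UW1] := UW; have WU1 := hyperbolic_WU symB UW.
have [z0 z1] := exists_neq01.
have [z [{}z0 _ {}z1]] := exists_expz_neq1 (nil : seq K) (isT : 2%:Z != 0).
have {}z1 : z * z != 1 by rewrite -expr2.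
have zn1 : z != 1 by apply: contraNneq z1 => ->; rewrite mulr1.
have pU i : polyfun (fun s => wU s 0 i) by apply: polymx_weights.
have pW i : polyfun (fun s => wW s 0 i) by apply: polymx_inv_weights.
have UU0 i j : (col i U)^T *m B *m col j U = 0 by rewrite form_col_mx UU mxE raddf0.
have WW0 i j : (col i W)^T *m B *m col j W = 0 by rewrite form_col_mx WW mxE raddf0.
have UW0 i j : i != j -> (col i U)^T *m B *m col j W = 0.
  by move=> ij; rewrite form_col_mx UW1 mxE (negPf ij) raddf0.
have UWi i : (col i U)^T *m B *m col i W = 1%:M by rewrite form_col_mx UW1 mxE eqxx.
have e0 : e != 0 by rewrite signr_eq0.
split=> [i j ij|ep i].
  have [ui wi] := col_hyperbolic_neq0 i; have [uj wj] := col_hyperbolic_neq0 j.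
  have [s Ts sE] := torus_coord i z0.
  (* At the point with t_i = z and the other t_j equal to 1 these characters take
     the value z. *)
  have ji : j == i = false by rewrite eq_sym (negPf ij).
  split.
    have /hroot : is_root (pointwise_fixer B (fixed_space T)) T (fun s => wU s 0 i * wW s 0 j).
      apply: (@root_vector (col i U) (col j W) _ _ (col j U)) => //.
      - by move=> s' Ts'; apply: torus_colU.
      - by move=> s' Ts'; apply: torus_colW.
      - exact: UW0.
      - by move=> v /col_hyperbolic_fixed h; split; [case: (h i)|case: (h j)].
      - rewrite UU0 mulmx0 scaler0 subr0 form_col_mx WU1 !mxE eqxx mul_mx_scalar.
        by rewrite mulr1 scaler_eq0 negb_or e0.
      by exists s => //; case: (sE i) => -> _; case: (sE j) => _ ->; rewrite eqxx ji mulr1.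
    rewrite (weights_tor symB UW) (inv_weights_tor symB UW) [tinv _ _ _]mxE => h.
    by apply: contraNneq h => ->; rewrite mulfV.
  have /hroot : is_root (pointwise_fixer B (fixed_space T)) T (fun s => wU s 0 i * wU s 0 j).
    apply: (@root_vector (col i U) (col j U) _ _ (col j W)) => //.
    - by move=> s' Ts'; apply: torus_colU.
    - by move=> s' Ts'; apply: torus_colU.
    - by move=> v /col_hyperbolic_fixed h; split; [case: (h i)|case: (h j)].
    - by rewrite (UW0 _ _ ij) mulmx0 scaler0 subr0 UWi mulmx1.
    by exists s => //; case: (sE i) => -> _; case: (sE j) => -> _; rewrite eqxx ji mulr1.
  by rewrite (weights_tor symB UW).
have [ui wi] := col_hyperbolic_neq0 i; have [s Ts sE] := torus_coord i z0.
have /hroot : is_root (pointwise_fixer B (fixed_space T)) T (fun s => wU s 0 i * wU s 0 i).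
  apply: (@root_vector (col i U) (col i U) _ _ (col i W)) => //.
  - by move=> s' Ts'; apply: torus_colU.
  - by move=> s' Ts'; apply: torus_colU.
  - by move=> v /col_hyperbolic_fixed h; split; case: (h i).
  - rewrite UWi mulmx1 ep scaleN1r opprK -mulr2n -scaler_nat scaler_eq0 negb_or.
    by rewrite two_neq0.
  by exists s => //; case: (sE i) => -> _; rewrite eqxx.
by rewrite (weights_tor symB UW).
Qed.

(** If the root takes the value 1 at a regular element, a root vector commutes with
    that element.  Its matrix in the hyperbolic family is then diagonal: for
    distinct eigenvalues this is clear, and the entry pairing u_i with w_i for
    t_i = -1, which occurs in the orthogonal case only, vanishes by skewness.  So
    the vector commutes with the whole torus, and the root is trivial. *)
Lemma regular_root_neq1 t alpha : regular t ->
  is_root (pointwise_fixer B (fixed_space T)) T alpha -> alpha (tor t) != 1.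
Proof.
move=> [ht h1 hd he] [_ [s0 Ts0 as0] [A [lieA A0 As]]]; apply/negP => /eqP at1.
pose C := Y *m A *m X.
have skew := lie_fixer_skew lieA.
(* A vanishes on the complement of the frame and, being skew, has its image in
   the span of the frame. *)
have AQ : A = A *m (X *m Y).
  apply/eqP; rewrite -subr_eq0 -{1}(mulmx1 A) -mulmxBr; apply/eqP/matrixP => i j.
  rewrite [RHS]mxE.
  have h := lie_fixer_kills lieA ((fixed_torus _).2 (fixed_proj (delta_mx j 0 : 'cV_n))).
  by move/matrixP/(_ i 0): h; rewrite mulmxA -colE mxE [RHS]mxE.
have QA : A = X *m Y *m A.
  apply: (can_inj (mulKmx unitB)); rewrite [in RHS]mulmxA -proj_adj -mulmxA.
  have BA : B *m A = - (A^T *m B) by apply/eqP; rewrite -addr_eq0 addrC skew.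
  by rewrite BA mulmxN mulmxA -trmx_mul -AQ.
have AC : A = X *m C *m Y by rewrite {1}QA {1}AQ /C !mulmxA.
have comm : torus_block t *m C = C *m torus_block t.
  have [ug _] := tor_isometry unitB symB UW ht.
  have gA : tor t *m A = A *m tor t.
    have := As _ (ex_intro2 _ _ _ ht erefl); rewrite at1 scale1r => E.
    by rewrite -[LHS](mulmxKV ug) E.
  have := congr1 (fun M => Y *m M *m X) gA; rewrite /C.
  rewrite !mulmxA (coords_frame_map XG) -!mulmxA (frame_map_frame XG) !mulmxA //.
have skewC : C^T *m hyperbolic_gram K eps m + hyperbolic_gram K eps m *m C = 0.
  transitivity (X^T *m (A^T *m B + B *m A) *m X); last by rewrite skew mulmx0 mul0mx.
  rewrite mulmxDr mulmxDl /C !trmx_mul -!mulmxA (form_coordsT symB XG).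
  by rewrite (mulmxA X^T B) (form_coords XG) !mulmxA.
clearbody C; pose a := ulsubmx C; pose b := ursubmx C; pose c := dlsubmx C; pose d := drsubmx C.
have CE : C = block_mx a b c d by rewrite submxK.
move: comm; rewrite CE /torus_block !mulmx_block !mul0mx !mulmx0 !addr0 !add0r.
move=> /eq_block_mx[aE bE cE dE].
move: skewC; rewrite CE /hyperbolic_gram tr_block_mx !mulmx_block add_block_mx.
rewrite -[X in _ = X]block_mx0 !mul0mx !mulmx0 !addr0 !add0r !mulmx1 !mul1mx.
rewrite -!scalemxAr -!scalemxAl !mulmx1 !mul1mx => /eq_block_mx[cc _ _ bb].
have entry (M : 'M[K]_m) (t1 t2 : 'rV[K]_m) i j :
    diag_mx t1 *m M = M *m diag_mx t2 -> M i j != 0 -> t1 0 i = t2 0 j.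
  move=> /matrixP/(_ i j); rewrite mul_diag_mx mul_mx_diag !mxE mulrC => E Mij.
  exact: (mulfI Mij).
have diag_comm (M : 'M[K]_m) u : (forall i j, M i j != 0 -> i = j) ->
    diag_mx u *m M = M *m diag_mx u.
  move=> dM; apply/matrixP => i j; rewrite mul_diag_mx mul_mx_diag !mxE mulrC.
  have [->|/dM->//] := eqVneq (M i j) 0; by rewrite !mul0r.
have t_inj i j : t 0 i = t 0 j -> i = j.
  by move=> tij; apply/eqP/negPn/negP => /hd[]; rewrite tij eqxx.
have antisym0 (M : 'M[K]_m) i : M^T + e *: M = 0 -> t 0 i * t 0 i = 1 -> M i i = 0.
  move=> MM ti; case ep : eps in MM he; first by move: (he isT i); rewrite ti eqxx.
  move/matrixP/(_ i i): MM; rewrite expr0 scale1r !mxE => /eqP.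
  by rewrite -mulr2n -[_ *+ 2]mulr_natl mulf_eq0 (negPf two_neq0) => /eqP.
(* b and c are the blocks that exchange the spans of U and W. *)
have b0 : b = 0.
  apply/matrixP => i j; rewrite [RHS]mxE; apply/eqP/negPn/negP => bij.
  have := entry _ _ _ _ _ bE bij; rewrite mxE => tij.
  have tt : t 0 i * t 0 j = 1 by rewrite tij mulVf.
  have ij : i = j by apply/eqP/negPn/negP => /hd[_]; rewrite tt eqxx.
  by case/negP: bij; rewrite -ij (antisym0 b) // {2}ij tt.
have c0 : c = 0.
  apply/matrixP => i j; rewrite [RHS]mxE; apply/eqP/negPn/negP => cij.
  have := entry _ _ _ _ _ cE cij; rewrite mxE => tij.
  have tt : t 0 i * t 0 j = 1 by rewrite -tij mulfV.
  have ij : i = j by apply/eqP/negPn/negP => /hd[_]; rewrite tt eqxx.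
  case/negP: cij; rewrite -ij (antisym0 c) //; last by rewrite {2}ij tt.
  have : e *: (e *: c^T + c) = 0 by rewrite cc scaler0.
  by rewrite scalerDr scalerA sgn_mulK scale1r.
have ad i j : a i j != 0 -> i = j by move=> /(entry _ _ _ _ _ aE)/t_inj.
have dd i j : d i j != 0 -> i = j.
  by move=> /(entry _ _ _ _ _ dE); rewrite !mxE => /invr_inj/t_inj.
have [t0 ht0 s0E] := Ts0; have [us0 _] := tor_isometry unitB symB UW ht0.
have commT : torus_block t0 *m C = C *m torus_block t0.
  rewrite CE b0 c0 /torus_block !mulmx_block !mul0mx !mulmx0 !addr0 !add0r.
  by rewrite (diag_comm a) // (diag_comm d).
have s0A : s0 *m A = A *m s0.
  rewrite s0E AC !mulmxA (frame_map_frame XG) -!mulmxA (coords_frame_map XG) !mulmxA.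
  by rewrite -(mulmxA X) commT mulmxA.
have := As _ Ts0; rewrite s0A mulmxK ?s0E // -s0E => E.
case/negP: as0; rewrite -subr_eq0; apply/eqP.
have /eqP : (alpha s0 - 1) *: A = 0 by rewrite scalerBl -E scale1r subrr.
by rewrite scaler_eq0 (negPf A0) orbF => /eqP.
Qed.

Lemma regular_partP g : regular_part B T g <-> exists2 t, regular t & g = tor t.
Proof.
split=> [[[t ht ->] hroot hinv]|[t [ht h1 hd he] ->]].
  have [hd he] := regular_of_roots ht hroot.
  by exists t => //; split=> // i; apply: invertible_regular.
split; first by exists t.
  by move=> alpha; apply: regular_root_neq1.
exact: regular_invertible.
Qed.

End RegularPart.

(** * Hankel determinants and ranks *)

Section HankelTraces.
Variable K : closedFieldType.

(** The only eigenvalue is 0, so the characteristic polynomial is a power of X. *)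
Lemma nilpotent_trace0 n (M : 'M[K]_n) q : M ^+ q = 0 -> \tr M = 0.
Proof.
case: n M => [|n] M Mq; first by rewrite /mxtrace big_ord0.
have [r rE] := closed_field_poly_normal (char_poly M).
rewrite (monicP (char_poly_monic M)) scale1r in rE.
have r0 a : a \in r -> a = 0.
  rewrite -root_prod_XsubC -rE -eigenvalue_root_char => /eigenvalueP[v vM v0].
  have vMq : v *m M ^+ q = a ^+ q *: v.
    elim: q {Mq} => [|q IH]; first by rewrite !expr0 mulmx1 scale1r.
    by rewrite exprSr mulmxA IH -scalemxAl vM scalerA -exprSr.
  move/esym/eqP: vMq; rewrite Mq mulmx0 scaler_eq0 (negPf v0) orbF expf_eq0.
  by case/andP => _ /eqP.
have cM : char_poly M = 'X^(n.+1).
  have sr : size r = n.+1.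
    by have := size_char_poly M; rewrite rE size_prod_XsubC => -[].
  rewrite rE big_seq (eq_bigr (fun=> 'X)) => [|a /r0->]; last by rewrite subr0.
  by rewrite -big_seq big_const_seq count_predT sr -Monoid.iteropE.
apply: oppr_inj; rewrite -char_poly_trace // cM coefXn /= oppr0.
by rewrite (ltn_eqF (ltnSn n)).
Qed.

Variables (a c : K).

(** The weight a N + c removes from the count the eigenvalue -c/a when a is nonzero. *)
Definition hankel m n (N : 'M[K]_n) : 'M[K]_m :=
  \matrix_(i, j) \tr (N ^+ (i + j).+1 *m (a *: N + c%:M)).

(** With fewer than m such eigenvalues, the polynomial phi that has them as simple
    roots has degree less than m.  The matrix N^(i+1) (a N + c) phi(N) is nilpotent, so its
    trace vanishes, and the coefficients of phi form a vector in the kernel of the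
    Hankel matrix. *)
Lemma hankel_eigenvalues m n (N : 'M[K]_n) : \det (hankel m N) != 0 ->
  exists2 mu : 'I_m -> K, injective mu &
    forall i, [/\ eigenvalue N (mu i), mu i != 0 & a * mu i + c != 0].
Proof.
case: m => [|m]; first by exists (fun=> 0) => -[].
case: n N => [|n] N.
  have -> : hankel m.+1 N = 0; last by rewrite det0 eqxx.
  by apply/matrixP => i j; rewrite !mxE /mxtrace big_ord0.
have [r rE] := closed_field_poly_normal (char_poly N).
rewrite (monicP (char_poly_monic N)) scale1r in rE.
(* The distinct eigenvalues that the Hankel matrix counts. *)
pose s := undup [seq x <- r | (x != 0) && (a * x + c != 0)].
have [sm|sm] := leqP m.+1 (size s).
  move=> _; exists (fun i : 'I_m.+1 => s`_i).
    move=> i j /eqP; rewrite nth_uniq ?undup_uniq ?(leq_trans (ltn_ord _)) //.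
    by move/eqP/val_inj.
  move=> i; have : s`_i \in s by rewrite mem_nth // (leq_trans (ltn_ord i)).
  rewrite mem_undup mem_filter => /andP[/andP[h1 h2] h3]; split=> //.
  by rewrite eigenvalue_root_char rE root_prod_XsubC.
move=> dH; case/negP: dH.
pose phi := \prod_(x <- s) ('X - x%:P).
have sphi : (size phi <= m.+1)%N by rewrite size_prod_XsubC.
have nil (i : nat) : \tr (N ^+ i.+1 *m (a *: N + c%:M) *m horner_mx N phi) = 0.
  pose th := 'X^(i.+1) * (a *: 'X + c%:P) * phi.
  have -> : N ^+ i.+1 *m (a *: N + c%:M) *m horner_mx N phi = horner_mx N th.
    rewrite /th !rmorphM /= rmorphXn rmorphD /= linearZ /= horner_mx_X horner_mx_C //.
  apply: (@nilpotent_trace0 _ _ (size r)).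
  rewrite -rmorphXn; apply/eqP.
  have /dvdpP[q ->] : char_poly N %| th ^+ size r; last first.
    by rewrite rmorphM /= Cayley_Hamilton mulr0.
  rewrite rE.
  have rth x : x \in r -> ('X - x%:P) %| th.
    move=> xr; rewrite dvdp_XsubCl /root /th !hornerE.
    have [->|x0] := eqVneq x 0; first by rewrite expr0n /= !mul0r.
    have [->|ac] := eqVneq (a * x + c) 0; first by rewrite mulr0 mul0r.
    have /eqP -> : root phi x; last by rewrite mulr0.
    by rewrite root_prod_XsubC mem_undup mem_filter x0 ac.
  elim: (r) rth => [|x r' IH] rth; first by rewrite big_nil dvd1p.
  rewrite big_cons exprS dvdp_mul ?rth ?mem_head // IH // => y yr.
  by rewrite rth // inE yr orbT.
pose v : 'cV[K]_m.+1 := \col_j phi`_j.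
have Hv : hankel m.+1 N *m v = 0.
  apply/colP => i; rewrite [RHS]mxE -(nil i) mxE.
  have -> : horner_mx N phi = \sum_(j < m.+1) phi`_j *: N ^+ j.
    have {1}-> : phi = \poly_(j < m.+1) phi`_j.
      apply/polyP => j; rewrite coef_poly; case: ltnP => // mj.
      by rewrite nth_default // (leq_trans sphi).
    rewrite poly_def raddf_sum /=; apply: eq_bigr => j _.
    by rewrite linearZ /= rmorphXn /= horner_mx_X.
  rewrite mulmx_sumr raddf_sum /=; apply: eq_bigr => j _.
  rewrite !mxE -scalemxAr mxtraceZ mulrC; congr (_ * \tr _).
  rewrite -mulmxA.
  have -> : (a *: N + c%:M) *m N ^+ j = N ^+ j *m (a *: N + c%:M).
    rewrite mulmxDl mulmxDr -scalemxAl -scalemxAr -scalar_mxC; congr (_ *: _ + _).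
    by rewrite -[LHS]exprS -[RHS]exprSr.
  by rewrite mulmxA -[X in _ = X *m _]exprD addSn.
apply/eqP; apply: contraTeq isT => dH; exfalso.
have uH : hankel m.+1 N \in unitmx by rewrite unitmxE unitfE.
have v0 : v = 0 by apply: (can_inj (mulKmx uH)); rewrite Hv mulmx0.
have : lead_coef phi = 1 by apply/eqP; apply: monic_prod_XsubC.
rewrite /lead_coef; have sphi' : ((size phi).-1 < m.+1)%N.
  by rewrite /phi size_prod_XsubC.
have /colP/(_ (Ordinal sphi')) := v0; rewrite !mxE /= => -> /esym/eqP.
by rewrite oner_eq0.
Qed.

Lemma diag_exp m (v : 'rV[K]_m) q : diag_mx v ^+ q = diag_mx (\row_i v 0 i ^+ q).
Proof.
elim: q => [|q IH].
  rewrite expr0 -[LHS]diag_const1; congr diag_mx; apply/rowP => i.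
  by rewrite !mxE expr0.
rewrite exprS IH -[LHS]diag_tmul; congr diag_mx; apply/rowP => i.
by rewrite !mxE exprS.
Qed.

(** The Hankel matrix is V D V^T with V the Vandermonde matrix of the nu_l and
    D diagonal with entries 2 nu_l (a nu_l + c). *)
Lemma hankel_split m n (N : 'M[K]_n) (X : 'M[K]_(n, m + m)) Y (nu : 'rV[K]_m) :
  2%:R != 0 :> K -> Y *m X = 1%:M ->
  N = X *m diag_mx (row_mx nu nu) *m Y -> injective (fun i => nu 0 i) ->
  (forall i, nu 0 i != 0 /\ a * nu 0 i + c != 0) -> \det (hankel m N) != 0.
Proof.
move=> two0 YX NE inj_nu nu0.
have [d [dE dl dr]] : exists d, [/\ d = row_mx nu nu,
    forall l, d 0 (lshift m l) = nu 0 l & forall l, d 0 (rshift m l) = nu 0 l].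
  by exists (row_mx nu nu); split=> // l; rewrite ?row_mxEl ?row_mxEr.
rewrite -{}dE in NE; set D := diag_mx d in NE.
have NX q : N ^+ q *m X = X *m D ^+ q.
  elim: q => [|q IH]; first by rewrite !expr0 mulmx1 mul1mx.
  by rewrite exprS -mulmxA IH NE -!mulmxA (mulmxA Y) YX mul1mx exprS.
have Npow q : N ^+ q.+1 = X *m D ^+ q.+1 *m Y.
  by rewrite exprSr {2}NE -[LHS]/(_ *m _) !mulmxA NX -(mulmxA X) -[D ^+ q *m D]exprSr.
have trN q : \tr (N ^+ q.+1 *m (a *: N + c%:M)) =
    \sum_l 2%:R * nu 0 l * (a * nu 0 l + c) * nu 0 l ^+ q.
  have trXY C : \tr (X *m C *m Y) = \tr C by rewrite mxtrace_mulC mulmxA YX mul1mx.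
  rewrite mulmxDr -scalemxAr -[_ *m N]exprSr mul_mx_scalar !Npow.
  rewrite mxtraceD !mxtraceZ !trXY /D !diag_exp !mxtrace_diag !big_split_ord /=.
  rewrite -!big_split !mulr_sumr -big_split; apply: eq_bigr => l _ /=.
  by rewrite !mxE dl dr !exprS; ring.
pose V := Vandermonde m nu.
have -> : hankel m N = V *m diag_mx (\row_l (2%:R * nu 0 l * (a * nu 0 l + c))) *m V^T.
  apply/matrixP => i j; rewrite mxE trN mul_mx_diag mxE; apply: eq_bigr => l _.
  by rewrite !mxE exprD; ring.
rewrite !det_mulmx det_tr det_Vandermonde det_diag.
have V0 : \prod_(i < m) \prod_(j < m | (i < j)%N) (nu 0 j - nu 0 i) != 0.
  apply/prodf_neq0 => i _; apply/prodf_neq0 => j ij; rewrite subr_eq0.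
  by apply/eqP => /inj_nu E; rewrite E ltnn in ij.
rewrite !mulf_neq0 //; apply/prodf_neq0 => l _; rewrite mxE.
by have [h1 h2] := nu0 l; rewrite !mulf_neq0.
Qed.

End HankelTraces.

(** Factoring A through its row space gives an invertible skew matrix M of size the
    rank r, and det M = det M^T = (-1)^r det M. *)
Lemma skew_rank_even (F : fieldType) n (A : 'M[F]_n) : 2%:R != 0 :> F ->
  A^T = - A -> ~~ odd (\rank A).
Proof.
move=> two0 AT; have [R' RR] := row_freeP (row_base_free A).
have CR := mulmx_base A; move: (row_base A) (col_base A) RR CR => R C RR CR.
have AR : A *m R' *m R = A.
  transitivity (C *m R *m R' *m R); first by rewrite CR.
  by rewrite -(mulmxA C) RR mulmx1 CR.
have RA : R^T *m R'^T *m A = A.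
  apply: trmx_inj; rewrite trmx_mul trmx_mul !trmxK AT !mulNmx mulmxA AR //.
pose M := R'^T *m A *m R'.
have AM : A = R^T *m M *m R by rewrite /M !mulmxA RA AR.
have uM : M \in unitmx.
  have le : (\rank (R^T *m M *m R) <= \rank M)%N.
    by rewrite (leq_trans (mxrankM_maxl _ _)) // mxrankM_maxr.
  by rewrite -row_full_unit /row_full eqn_leq rank_leq_col /=; rewrite -AM in le.
have MT : M^T = - M by rewrite /M !trmx_mul trmxK AT mulNmx mulmxN mulmxA.
apply/negP => odd_r; have := det_tr M; rewrite MT -scaleN1r detZ -signr_odd odd_r expr1.
move/eqP; rewrite mulN1r eq_sym -subr_eq0 opprK -mulr2n -[_ *+ 2]mulr_natl.
rewrite mulf_eq0 (negPf two0) /= => /eqP d0.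
by move: uM; rewrite unitmxE d0 unitr0.
Qed.

(** With the next lemma, this shows that a lower bound on the rank is an open
    condition: the determinant of L A R is a polynomial in A. *)
Lemma rank_minor (F : fieldType) m n (A : 'M[F]_(m, n)) :
  exists (L : 'M_(\rank A, m)) (R : 'M_(n, \rank A)), L *m A *m R = 1%:M.
Proof.
(* One-sided inverses of the two factors of a rank factorization of A. *)
have [C CC] := row_freeP (row_base_free A).
have [D DD] := row_fullP (col_base_full A).
exists D, C; have E := mulmx_base A.
transitivity (D *m (col_base A *m row_base A) *m C); first by rewrite E.
by rewrite mulmxA DD mul1mx CC.
Qed.

Lemma minor_rank (F : fieldType) m n k (A : 'M[F]_(m, n)) (L : 'M_(k, m)) (R : 'M_(n, k)) :
  \det (L *m A *m R) != 0 -> (k <= \rank A)%N.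
Proof.
rewrite -unitfE -unitmxE -row_full_unit => /eqP {1}<-.
by rewrite (leq_trans (mxrankM_maxl _ _)) // mxrankM_maxr.
Qed.

Section SquareRootsOfOne.
Variables (F : fieldType) (n : nat) (g : 'M[F]_n).
Hypothesis two_neq0 : 2%:R != 0 :> F.

Lemma rank_eigenspace2 (a b : F) : a != b ->
  \rank (eigenspace g a + eigenspace g b)%MS =
  (\rank (eigenspace g a) + \rank (eigenspace g b))%N.
Proof.
move=> ab; have dx : mxdirect (\sum_(i : bool) eigenspace g (if i then a else b))%MS.
  by apply: mxdirect_sum_eigenspace => -[] [] _ _ //= E; rewrite E eqxx in ab.
by have /mxdirectP := dx; rewrite /= !big_bool.
Qed.

Lemma sqr_comm : (g - 1%:M) *m (g + 1%:M) = (g + 1%:M) *m (g - 1%:M).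
Proof.
rewrite mulmxBl mulmxDl !mulmxDr !mulmxN !mulmx1 !mul1mx opprD !addrA.
by rewrite addrK subrK.
Qed.

(** Every v killed by g^2 - 1 is half the difference of v (g + 1) and v (g - 1), which
    are eigenvectors for 1 and -1. *)
Lemma rank_ker_sqr_sub1 :
  \rank (kermx ((g - 1%:M) *m (g + 1%:M))) =
  (\rank (eigenspace g 1) + \rank (eigenspace g (-1)))%N.
Proof.
rewrite -rank_eigenspace2; last first.
  by rewrite -subr_eq0 opprK -(natrD _ 1 1).
apply/eqP; rewrite eqn_leq; apply/andP; split; apply: mxrankS; last first.
  rewrite addsmx_sub; apply/andP; split; apply/sub_kermxP.
    by rewrite mulmxA (sub_kermxP (submx_refl _)) mul0mx.
  rewrite sqr_comm mulmxA; have -> : g + 1%:M = g - (-1)%:M by rewrite raddfN opprK.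
  by rewrite (sub_kermxP (submx_refl _)) mul0mx.
set V := kermx _; have VE : V *m (g - 1%:M) *m (g + 1%:M) = 0.
  by rewrite -mulmxA; apply/sub_kermxP.
have VE' : V *m (g + 1%:M) *m (g - 1%:M) = 0.
  by rewrite -VE -!mulmxA sqr_comm.
have -> : V = 2%:R^-1 *: (V *m (g + 1%:M)) + (- 2%:R^-1) *: (V *m (g - 1%:M)).
  rewrite scaleNr -scalerBr -mulmxBr opprB [g + _ + _]addrC addrA subrK mulmxDr mulmx1.
  by rewrite -mulr2n -scaler_nat scalerA mulVf // scale1r.
apply: addmx_sub_adds; apply: scalemx_sub; apply/eigenspaceP; apply/eqP.
  by rewrite scale1r -subr_eq0 -{2}[_ *m (g + _)]mulmx1 -mulmxBr VE'.
by rewrite scaleN1r -addr_eq0 -{2}[_ *m (g - _)]mulmx1 -mulmxDr VE.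
Qed.

End SquareRootsOfOne.

(** * Eigenspaces of h + h^-1 - 2 *)

Section SymmetricPart.
Variables (K : closedFieldType) (n : nat) (B : 'M[K]_n) (eps : bool).
Hypothesis two_neq0 : 2%:R != 0 :> K.
Hypothesis unitB : B \in unitmx.
Hypothesis symB : B^T = (-1) ^+ eps *: B.
Local Notation e := ((-1) ^+ eps : K).

(** This is h + h^-1 - 2 when h is an isometry; in this form it is a polynomial in
    the entries of h. *)
Definition sym_part (h : 'M[K]_n) := h + invmx B *m h^T *m B - 2%:R%:M.

Lemma polymx_sym_part : polymx sym_part.
Proof. by rewrite /sym_part; polymx_tac. Qed.

Lemma sym_partE h : isometries B h -> sym_part h = h + invmx h - 2%:R%:M.
Proof. by move=> hh; rewrite /sym_part -isometries_inv. Qed.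

(** The eigenvalue of the symmetric part on an eigenvector of h for t; the
    eigenvalue t^-1 gives the same value. *)
Definition trace_ev (t : K) := t + t^-1 - 2%:R.

Lemma trace_ev_surj mu : exists2 t, t != 0 & trace_ev t = mu.
Proof.
have [c cE] : exists c, c = mu + 2%:R by exists (mu + 2%:R).
have [t] : exists t, root ('X^2 - c *: 'X + 1) t.
  apply/closed_rootP; rewrite -addrA size_polyDl ?size_polyXn // ltnS.
  rewrite (leq_trans (size_polyD _ _)) // geq_max size_poly1 andbT size_polyN.
  by rewrite (leq_trans (size_scale_leq _ _)) // size_polyX.
rewrite rootE !hornerE => /eqP E.
have t0 : t != 0.
  apply: contra_eq_neq E => ->; rewrite /= !(mulr0, mul0r, subr0, add0r) //.
  by rewrite expr0n add0r oner_neq0.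
exists t => //; rewrite /trace_ev; apply: (mulfI t0).
rewrite mulrBr mulrDr mulfV //.
have -> : t * t + 1 - t * 2%:R = (t ^+ 2 - c * t + 1) + t * mu.
  by rewrite cE; ring.
by rewrite E add0r.
Qed.

Lemma isometry_eig_orth h (u v : 'cV[K]_n) a b : isometries B h ->
  h *m u = a *: u -> h *m v = b *: v -> a * b != 1 -> u^T *m B *m v = 0.
Proof.
move=> [_ hB] hu hv ab.
have : (h *m u)^T *m B *m (h *m v) = u^T *m B *m v.
  by rewrite trmx_mul -!mulmxA (mulmxA B) (mulmxA h^T) (mulmxA h^T) hB.
rewrite hu hv [(_ *: _)^T]linearZ /= -!scalemxAl -scalemxAr scalerA => /eqP.
rewrite -subr_eq0 -[X in _ - X]scale1r -scalerBl scaler_eq0 subr_eq0.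
by rewrite (negPf ab) => /eqP.
Qed.

Section OneIsometry.
Variable h : 'M[K]_n.
Hypothesis hh : isometries B h.
Let uh := hh.1.
Local Notation M := (sym_part h)^T.
Local Notation g := (h^T).

(** The matrix h^-1 - t is conjugate by B to the transpose of h - t. *)
Lemma isometry_sub_unit t : t != 0 -> h - t%:M \in unitmx -> h - t^-1%:M \in unitmx.
Proof.
move=> t0 ut.
have -> : h - t^-1%:M = (- t^-1) *: (h *m (invmx B *m (h - t%:M)^T *m B)).
  rewrite [(h - _)^T]linearB /= tr_scalar_mx mulmxBr mulmxBl -isometries_inv //.
  rewrite mulmxBr mulmxV // mul_mx_scalar -scalemxAl mulVmx // -scalemxAr mulmx1.
  rewrite scalerBr scalerA mulNr mulVf // scaleN1r opprK scaleNr scalemx1 addrC //.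
rewrite unitmxZ ?unitfE ?oppr_eq0 ?invr_eq0 // !unitmx_mul uh unitB unitmx_inv unitB.
by rewrite unitmx_tr ut.
Qed.

Lemma isometry_sub_inv_unit t : t != 0 ->
  (h - t%:M \in unitmx) = (h - t^-1%:M \in unitmx).
Proof.
move=> t0; apply/idP/idP; first exact: isometry_sub_unit.
by move=> /isometry_sub_unit; rewrite invrK invr_eq0 => /(_ t0).
Qed.

Lemma sym_part_factor t : t != 0 ->
  sym_part h - (trace_ev t)%:M = invmx h *m (h - t%:M) *m (h - t^-1%:M).
Proof.
move=> t0; rewrite sym_partE //.
rewrite [invmx h *m _]mulmxBr mulVmx // mul_mx_scalar mulmxBl mul1mx mulmxBr.
rewrite -!scalemxAl mulVmx // !mul_mx_scalar scalerA mulfV // scale1r.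
rewrite /trace_ev; apply/matrixP => i j; rewrite !mxE.
by case: (i == j); rewrite ?mulr1n ?mulr0n; ring.
Qed.

(** As h + h^-1 - t - t^-1 = h^-1 (h - t) (h - t^-1), one of h - t and h - t^-1 is
    singular, hence both are. *)
Lemma eigenspace_neq0 t : t != 0 -> eigenvalue (sym_part h) (trace_ev t) ->
  eigenspace g t != 0 /\ eigenspace g t^-1 != 0.
Proof.
move=> t0; rewrite /eigenvalue /eigenspace kermx_eq0 row_free_unit sym_part_factor //.
rewrite !unitmx_mul unitmx_inv uh -isometry_sub_inv_unit // andbb => nu.
have tr a : (h^T - a%:M) = (h - a%:M)^T by rewrite linearB /= tr_scalar_mx.
by rewrite !kermx_eq0 !row_free_unit !tr !unitmx_tr -isometry_sub_inv_unit // nu.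
Qed.

Lemma eigenspace_sym_part t : t != 0 ->
  (eigenspace g t <= eigenspace M (trace_ev t))%MS.
Proof.
move=> t0; apply/eigenspaceP.
have E : eigenspace g t *m g = t *: eigenspace g t by apply/eigenspaceP.
have ug : g \in unitmx by rewrite unitmx_tr.
have EV : eigenspace g t *m invmx g = t^-1 *: eigenspace g t.
  apply: (can_inj (mulmxK ug)); rewrite mulmxKV // -scalemxAl E scalerA mulVf //.
  by rewrite scale1r.
rewrite sym_partE // [(_ - _)^T]linearB /= [(_ + _)^T]linearD /= trmx_inv tr_scalar_mx.
by rewrite mulmxBr mulmxDr E EV mul_mx_scalar -scalerDl -scalerBl.
Qed.

Lemma eigenspace_sym_partV t : t != 0 ->
  (eigenspace g t^-1 <= eigenspace M (trace_ev t))%MS.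
Proof.
move=> t0; have -> : trace_ev t = trace_ev t^-1 by rewrite /trace_ev invrK [t^-1 + t]addrC.
by apply: eigenspace_sym_part; rewrite invr_eq0.
Qed.

(** For Y = h - h^-1 the matrix B Y is skew, so Y has even rank; and its kernel is the
    sum of the eigenspaces of h for 1 and -1. *)
Lemma eigenspaceN1_even : eps = false -> ~~ odd (\rank (h - 1%:M)) ->
  ~~ odd (\rank (eigenspace g (-1))).
Proof.
move=> ep even_r.
have ug : g \in unitmx by rewrite unitmx_tr.
pose Y := h - invmx h.
have BY : (B *m Y)^T = - (B *m Y).
  rewrite trmx_mul symB ep expr0 scale1r /Y [(_ - _)^T]linearB /= mulmxBl mulmxBr.
  by rewrite isometry_adj // isometry_adjV // opprB.
have := skew_rank_even two_neq0 BY.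
have rB (C : 'M[K]_n) : \rank (B *m C) = \rank C.
  by rewrite eqmxMfull // row_full_unit.
rewrite rB => even_Y.
have YE : Y^T = (g - 1%:M) *m (g + 1%:M) *m invmx g.
  rewrite /Y [(_ - _)^T]linearB /= trmx_inv mulmxBl mulmxDr !mulmx1 mul1mx opprD addrA.
  by rewrite addrK mulmxBl mulmxK // mul1mx.
have := rank_ker_sqr_sub1 g two_neq0; rewrite mxrank_ker.
have -> : \rank ((g - 1%:M) *m (g + 1%:M)) = \rank Y.
  by rewrite -(mxrank_tr Y) YE; apply/esym/mxrankMfree; rewrite row_free_unit unitmx_inv.
have -> : \rank (eigenspace g 1) = (n - \rank (h - 1%:M)%R)%N.
  rewrite /eigenspace mxrank_ker -(mxrank_tr (h - _)) [(_ - _)^T]linearB /= trmx1 //.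
move=> E; have := rank_leq_row Y; have := rank_leq_row (h - 1%:M).
move=> r1 r2.
have E2 : \rank (h - 1%:M) = (\rank (eigenspace g (-1)%R) + \rank Y)%N.
  by move: E r1 r2; rewrite -/Y; lia.
by move: even_r; rewrite E2 oddD (negPf even_Y) addbF.
Qed.

End OneIsometry.
End SymmetricPart.

(** * Recognising regular elements *)

Section TraceEigenvalues.
Variable K : closedFieldType.

(** The difference of the two values is (a - b) (a b - 1) / (a b). *)
Lemma trace_ev_eq (a b : K) : a != 0 -> b != 0 -> trace_ev a = trace_ev b ->
  a = b \/ a * b = 1.
Proof.
move=> a0 b0 E.
have : (a - b) * (a * b - 1) = 0.
  have -> : (a - b) * (a * b - 1) = (a + a^-1 - (b + b^-1)) * (a * b).
    by field; rewrite a0 b0.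
  by move/eqP: E; rewrite /trace_ev (inj_eq (subIr _)) => /eqP ->; rewrite subrr mul0r.
by move/eqP; rewrite mulf_eq0 !subr_eq0 => /orP[]/eqP; auto.
Qed.

(** The value is (a - 1)^2 / a. *)
Lemma trace_ev_neq0 (a : K) : a != 0 -> a != 1 -> trace_ev a != 0.
Proof.
move=> a0 a1; apply: contra_neq a1 => E; apply/eqP; rewrite -subr_eq0 -sqrf_eq0.
have -> : (a - 1) ^+ 2 = trace_ev a * a by rewrite /trace_ev; field.
by rewrite E mul0r.
Qed.

(** The sum is (a + 1)^2 / a. *)
Lemma trace_evN4 (a : K) : a != 0 -> a * a != 1 -> trace_ev a + 4%:R != 0.
Proof.
move=> a0 a1; apply: contra_neq a1 => E; apply/eqP; rewrite -subr_eq0.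
have a2 : (a + 1) ^+ 2 = 0.
  have -> : (a + 1) ^+ 2 = (trace_ev a + 4%:R) * a by rewrite /trace_ev; field.
  by rewrite E mul0r.
have -> : a * a - 1 = (a + 1) * (a - 1) by ring.
by move/eqP: a2; rewrite sqrf_eq0 => /eqP ->; rewrite mul0r.
Qed.

Lemma sqr_eq1_N1 (a : K) : a * a = 1 -> a != 1 -> a = -1.
Proof.
move=> aa a1; have : (a - 1) * (a + 1) = 0 by ring: aa.
by move/eqP; rewrite mulf_eq0 subr_eq0 (negPf a1) addr_eq0 => /eqP.
Qed.

End TraceEigenvalues.

Section EigenspaceAnalysis.
Variables (K : closedFieldType) (n : nat) (B : 'M[K]_n) (eps : bool).
Hypothesis two_neq0 : 2%:R != 0 :> K.
Hypothesis unitB : B \in unitmx.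
Hypothesis symB : B^T = (-1) ^+ eps *: B.
Local Notation e := ((-1) ^+ eps : K).
Local Notation tor := (torus_elt B eps).
Local Notation sym_part := (sym_part B).
Variable m : nat.
Local Notation regular := (@regular K eps m).

Section Recognise.
Variables (h : 'M[K]_n) (t : 'rV[K]_m).
Hypothesis hh : isometries B h.
Hypothesis rank_h : \rank (h - 1%:M) = (m + m)%N.
Hypothesis regt : regular t.
Hypothesis eig_h : forall i, eigenvalue (sym_part h) (trace_ev (t 0 i)).
Local Notation g := (h^T).
Let E i := eigenspace (sym_part h)^T (trace_ev (t 0 i)).

Let t0 i : t 0 i != 0. Proof. by case: regt. Qed.
Let t1 i : t 0 i != 1. Proof. by case: regt. Qed.

Lemma trace_ev_inj i j : trace_ev (t 0 i) = trace_ev (t 0 j) -> i = j.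
Proof.
case: regt => _ _ ht _ /(trace_ev_eq (t0 i) (t0 j)) tij.
apply/eqP/negPn/negP => /ht[]; case: tij => ->; rewrite eqxx //.
Qed.

Lemma eigenspace_rank_gt0 a i : a = t 0 i \/ a = (t 0 i)^-1 ->
  (0 < \rank (eigenspace g a))%N.
Proof.
move=> ha; rewrite lt0n mxrank_eq0.
by have [h1 h2] := eigenspace_neq0 unitB hh (t0 i) (eig_h i); case: ha => ->.
Qed.

Lemma neq_inv i : t 0 i * t 0 i != 1 -> t 0 i != (t 0 i)^-1.
Proof. by apply: contraNneq => E1; rewrite {2}E1 mulfV. Qed.

(** Only the orthogonal case allows t_i = -1, and then the even multiplicity of -1
    makes it at least 2. *)
Lemma eigenspace_tN1 i : t 0 i * t 0 i = 1 ->
  [/\ t 0 i = -1, eps = false & (2 <= \rank (eigenspace g (-1)))%N].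
Proof.
move=> tt; have tN := sqr_eq1_N1 tt (t1 i).
have ep : eps = false.
  by apply/negP => ep; case: regt => _ _ _ /(_ ep i); rewrite tt eqxx.
split=> //; have := eigenspaceN1_even two_neq0 unitB symB hh ep.
rewrite rank_h addnn odd_double => /(_ isT).
have := @eigenspace_rank_gt0 (-1) i (or_introl (esym tN)).
by case: (\rank _) => [|[|r]].
Qed.

Lemma eigenspaces_rank_ge2 i : (2 <= \rank (E i))%N.
Proof.
have [tt|/eqP tt] := eqVneq (t 0 i * t 0 i) 1.
  have [tN ep r2] := eigenspace_tN1 tt; apply: leq_trans r2 _.
  by rewrite -tN; apply: mxrankS; apply: eigenspace_sym_part.
apply: leq_trans (mxrankS (_ : (eigenspace g (t 0 i) + eigenspace g (t 0 i)^-1 <= E i)%MS)).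
  rewrite rank_eigenspace2 ?neq_inv //; last exact/eqP.
  by rewrite -(addn1 1) leq_add // (@eigenspace_rank_gt0 _ i); auto.
by rewrite addsmx_sub eigenspace_sym_part // eigenspace_sym_partV.
Qed.

Lemma eigenspaces_sub_image i : (E i <= (h - 1%:M)^T)%MS.
Proof.
have EE : E i *m (sym_part h)^T = trace_ev (t 0 i) *: E i by apply/eigenspaceP.
have mu0 := trace_ev_neq0 (t0 i) (t1 i).
have -> : E i = (trace_ev (t 0 i))^-1 *: (E i *m (sym_part h)^T).
  by rewrite EE scalerA mulVf // scale1r.
have := sym_part_factor unitB hh (oner_neq0 K).
rewrite invr1 {1}/trace_ev invr1 subrr raddf0 subr0 => ->.
have comm : invmx h *m (h - 1%:M) = (h - 1%:M) *m invmx h.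
  by rewrite mulmxBr mulmxBl mulVmx ?mulmxV ?hh.1 // mulmx1 mul1mx.
by rewrite comm -(mulmxA (h - 1%:M)) trmx_mul (mulmxA (E i)) scalemx_sub // submxMl.
Qed.

(** The m independent eigenspaces, of dimension at least 2, lie in the image of h - 1,
    whose dimension is 2m. *)
Lemma image_sub_eigenspaces : ((h - 1%:M)^T <= \sum_i E i)%MS /\ forall i, \rank (E i) = 2%N.
Proof.
have dx : mxdirect (\sum_i E i)%MS.
  by apply: mxdirect_sum_eigenspace => i j _ _ /trace_ev_inj.
have rS : \rank (\sum_i E i)%MS = (\sum_i \rank (E i))%N by apply/mxdirectP.
have sS : (\sum_i E i <= (h - 1%:M)^T)%MS by apply/sumsmx_subP => i _; apply: eigenspaces_sub_image.
have le1 := mxrankS sS; rewrite mxrank_tr rank_h rS in le1.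
have le2 := leqif_sum (fun (i : 'I_m) (_ : true) => leqif_eq (eigenspaces_rank_ge2 i)).
have c2 : (\sum_(i < m) 2 = m + m)%N by rewrite sum_nat_const card_ord muln2 addnn.
rewrite c2 in le2.
have eqr : (\sum_i \rank (E i) = m + m)%N by apply/eqP; rewrite eqn_leq le1 le2.
split.
  by rewrite -(geq_leqif (mxrank_leqif_sup sS)) mxrank_tr rank_h rS eqr.
have := le2.2; rewrite eqr eqxx => /esym/forallP h2 i.
by have /eqP <- := h2 i.
Qed.

(** Such a vector is orthogonal to the image of h - 1, and the orthogonal of this
    image is the kernel of h - 1. *)
Lemma orth_eigenspaces_fixed (z : 'cV[K]_n) :
  (forall i, E i <= kermx (B *m z))%MS -> h *m z = z.
Proof.
move=> hz; have [sub _] := image_sub_eigenspaces; have [uh hB] := hh.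
have : ((h - 1%:M)^T <= kermx (B *m z))%MS.
  by apply: submx_trans sub _; apply/sumsmx_subP => i _.
move/sub_kermxP; rewrite [(_ - _)^T]linearB /= trmx1 mulmxBl mul1mx => /eqP.
rewrite subr_eq0 => /eqP Bz.
apply: (can_inj (mulKmx unitB)).
have ug : g \in unitmx by rewrite unitmx_tr.
by apply: (can_inj (mulKmx ug)); rewrite !mulmxA hB -mulmxA Bz.
Qed.

(** The symmetric part is self-adjoint. *)
Lemma eigenspaces_orth i j (v w : 'rV[K]_n) : i != j -> (v <= E i)%MS -> (w <= E j)%MS ->
  v *m B *m w^T = 0.
Proof.
move=> ij /eigenspaceP vE /eigenspaceP wE.
have sa : (sym_part h)^T *m B = B *m sym_part h.
  have [uh hB] := hh; rewrite sym_partE // [(_ - _)^T]linearB /= [(_ + _)^T]linearD /= tr_scalar_mx.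
  rewrite mulmxBl mulmxDl mulmxBr mulmxDr scalar_mxC.
  rewrite isometry_adj // isometry_adjV //.
  by rewrite [B *m _ + _]addrC.
have : v *m (sym_part h)^T *m B *m w^T = v *m B *m (w *m (sym_part h)^T)^T.
  by rewrite trmx_mul trmxK -!mulmxA (mulmxA _^T B) sa !mulmxA.
rewrite vE wE [(_ *: _)^T]linearZ /= -!scalemxAl -scalemxAr => /eqP.
rewrite -subr_eq0 -scalerBl scaler_eq0 subr_eq0 => /orP[/eqP/trace_ev_inj ij'|/eqP //].
by rewrite ij' eqxx in ij.
Qed.

(** The eigenspace is a nondegenerate plane: a vector of it that is orthogonal to
    it is orthogonal to all the eigenspaces, hence fixed by h, whereas t_i <> 1.
    If t_i^2 <> 1, the plane is the sum of the isotropic eigenlines for t_i and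
    t_i^-1.  If t_i = -1, h acts on it as -1 and any hyperbolic basis will do. *)
Lemma hyperbolic_eigenpair i : exists u w : 'cV[K]_n,
  [/\ h *m u = t 0 i *: u, h *m w = (t 0 i)^-1 *: w,
      u^T *m B *m u = 0, w^T *m B *m w = 0 & u^T *m B *m w = 1%:M].
Proof.
have trE (a : K) (v : 'rV[K]_n) : (v <= eigenspace g a)%MS -> h *m v^T = a *: v^T.
  by move=> /eigenspaceP vE; apply: trmx_inj; rewrite trmx_mul trmxK linearZ /= trmxK.
have rowsub (A : 'M[K]_n) z : (forall v : 'rV_n, (v <= A)%MS -> v *m z = 0) ->
    (A <= kermx (z : 'cV[K]_n))%MS.
  move=> hA; apply/rV_subP => v vA; apply/sub_kermxP; exact: hA.
have [_ rE] := image_sub_eigenspaces.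
have others (v : 'rV[K]_n) : (v <= E i)%MS -> forall j, j != i ->
    (E j <= kermx (B *m v^T))%MS.
  move=> vi j ji; apply: rowsub => w wj; rewrite mulmxA.
  exact: (eigenspaces_orth ji).
have [tt|/eqP tt] := eqVneq (t 0 i * t 0 i) 1.
  have [tN ep r2] := eigenspace_tN1 tt.
  have sub : (eigenspace g (-1) <= E i)%MS by rewrite -tN; apply: eigenspace_sym_part.
  have eqE : (E i <= eigenspace g (-1))%MS.
    by rewrite -(geq_leqif (mxrank_leqif_sup sub)) rE.
  have r2' : \rank (eigenspace g (-1)) = 2%N.
    by apply/eqP; rewrite eqn_leq r2 andbT -(rE i) mxrankS.
  have [X [XE frX]] : exists X : 'M[K]_(2, n), (X :=: eigenspace g (-1))%MS /\ row_free X.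
    rewrite -r2'; exists (row_base (eigenspace g (-1))); split; last exact: row_base_free.
    exact: eq_row_base.
  have XgE : h *m X^T = - X^T.
    apply: trmx_inj; rewrite trmx_mul trmxK [RHS]linearN /= trmxK -scaleN1r.
    by apply/eigenspaceP; rewrite XE.
  pose G := X *m B *m X^T.
  have GT : G^T = (-1) ^+ false *: G.
    by rewrite /G !trmx_mul trmxK symB ep !expr0 !scale1r mulmxA.
  (* A vector of the radical of G would be fixed by h, which acts as -1. *)
  have uG : G \in unitmx.
    rewrite -row_free_unit -kermx_eq0; apply/negPn/negP => /rowV0Pn[w /sub_kermxP wG w0].
    have wX : (w *m X <= eigenspace g (-1))%MS by rewrite -XE submxMl.
    have fix_z : h *m (w *m X)^T = (w *m X)^T.
      apply: orth_eigenspaces_fixed => j; have [->|ji] := eqVneq j i; last first.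
        by apply: others => //; apply: submx_trans wX sub.
      apply: submx_trans eqE _; rewrite -XE; apply/sub_kermxP.
      rewrite trmx_mul !mulmxA -/G; apply: trmx_inj.
      by rewrite trmx_mul trmxK GT expr0 scale1r wG trmx0.
    have := trE _ _ wX; rewrite fix_z scaleN1r => /eqP.
    rewrite -subr_eq0 opprK -mulr2n -scaler_nat scaler_eq0 (negPf two_neq0) /=.
    rewrite trmx_eq0 => /eqP E0; case/eqP: w0.
    by apply: (row_free_inj frX); rewrite E0 mul0mx.
  have [U [W [UU WW UW]]] := exists_hyperbolic two_neq0 uG GT (isT : (1 + 1 <= 2)%N).
  have BX (V V' : 'cV[K]_2) : (X^T *m V)^T *m B *m (X^T *m V') = V^T *m G *m V'.
    by rewrite trmx_mul trmxK /G !mulmxA.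
  exists (X^T *m U), (X^T *m W); rewrite !BX tN invrN1 !scaleN1r.
  by split=> //; rewrite mulmxA XgE mulNmx.
have tV := neq_inv (introN eqP tt).
have st := eigenspace_sym_part unitB hh (t0 i).
have stV := eigenspace_sym_partV unitB hh (t0 i).
have Esub : (E i <= eigenspace g (t 0 i) + eigenspace g (t 0 i)^-1)%MS.
  have sub : (eigenspace g (t 0 i) + eigenspace g (t 0 i)^-1 <= E i)%MS.
    by rewrite addsmx_sub st stV.
  rewrite -(geq_leqif (mxrank_leqif_sup sub)) rE rank_eigenspace2 //.
  by rewrite -(addn1 1) leq_add // (@eigenspace_rank_gt0 _ i); auto.
have /rowV0Pn[u ut u0] : eigenspace g (t 0 i) != 0.
  by rewrite -mxrank_eq0 -lt0n (@eigenspace_rank_gt0 _ i); auto.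
have [w [wt uw]] : exists w : 'rV[K]_n, (w <= eigenspace g (t 0 i)^-1)%MS /\ w *m B *m u^T != 0.
  apply: NNPP => H.
  have : h *m u^T = u^T.
    apply: orth_eigenspaces_fixed => j; have [->|ji] := eqVneq j i; last first.
      by apply: others => //; apply: submx_trans ut st.
    apply: submx_trans Esub _; rewrite addsmx_sub; apply/andP; split; apply: rowsub => v vt.
      rewrite mulmxA -(trmxK v); apply: (isometry_eig_orth hh (trE _ _ vt) (trE _ _ ut)).
      exact/eqP.
    by rewrite mulmxA; apply/eqP/negPn/negP => vu; apply: H; exists v.
  rewrite (trE _ _ ut) => /eqP; rewrite -subr_eq0 -{2}(scale1r u^T) -scalerBl scaler_eq0.
  by rewrite subr_eq0 (negPf (t1 i)) trmx_eq0 (negPf u0).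
have [c cE] : exists c : K, u *m B *m (c *: w)^T = 1%:M.
  have : u *m B *m w^T != 0.
    apply: contraNneq uw => E0; rewrite -(trmxK w) (form_sym0 symB) // trmxK //.
  rewrite [u *m B *m w^T]mx11_scalar scalar_mx11_eq0 => c0; exists ((u *m B *m w^T) 0 0)^-1.
  rewrite linearZ /= -scalemxAr [u *m B *m w^T]mx11_scalar scale_scalar_mx.
  by rewrite [_%:M 0 0]mxE eqxx mulr1n mulVf.
have cwt : (c *: w <= eigenspace g (t 0 i)^-1)%MS by apply: scalemx_sub.
exists u^T, (c *: w)^T; rewrite (trE _ _ ut) (trE _ _ cwt); split=> //; last by rewrite trmxK.
  by apply: (isometry_eig_orth hh (trE _ _ ut) (trE _ _ ut)); apply/eqP.
apply: (isometry_eig_orth hh (trE _ _ cwt) (trE _ _ cwt)).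
by rewrite -invfM invr_eq1; apply/eqP.
Qed.

Lemma recognise_torus : exists U W : 'M[K]_(n, m), hyperbolic B U W /\ h = tor U W t.
Proof.
have /fin_all_exists[u /fin_all_exists[w uwE]] := hyperbolic_eigenpair.
pose U := \matrix_(a, i) u i a 0; pose W := \matrix_(a, i) w i a 0.
have cU i : col i U = u i by apply/matrixP => r c; rewrite !mxE ord1.
have cW i : col i W = w i by apply/matrixP => r c; rewrite !mxE ord1.
have [_ _ ht _] := regt.
have UW : hyperbolic B U W.
  split; apply/matrixP => i j; rewrite (form_cols B) ?cU ?cW [RHS]mxE;
    have [hi hi' ui wi uwi] := uwE i; have [hj hj' uj wj uwj] := uwE j.
  - have [<-|ij] := eqVneq i j; first by rewrite ui mxE.
    by rewrite (isometry_eig_orth hh hi hj) ?mxE; have [] := ht _ _ ij.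
  - have [<-|ij] := eqVneq i j; first by rewrite wi mxE.
    rewrite (isometry_eig_orth hh hi' hj') ?mxE // -invfM invr_eq1.
    by have [] := ht _ _ ij.
  have [<-|ij] := eqVneq i j; first by rewrite uwi mxE eqxx.
  rewrite (isometry_eig_orth hh hi hj') ?mxE //.
  by apply: contraNneq (ht _ _ ij).1 => E1; rewrite -[X in X == _](mulfVK (t0 j)) E1 mul1r.
exists U, W; split=> //.
apply: (tor_recognize symB UW hh t0 t1); last by rewrite rank_h.
  by apply: mul_diag_cols => i; rewrite cU; case: (uwE i).
by apply: mul_diag_cols => i; rewrite cW mxE; case: (uwE i).
Qed.

End Recognise.
End EigenspaceAnalysis.

(** * Openness *)

Section Openness.
Variables (K : closedFieldType) (n : nat) (B : 'M[K]_n) (eps : bool).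
Hypothesis two_neq0 : 2%:R != 0 :> K.
Hypothesis unitB : B \in unitmx.
Hypothesis symB : B^T = (-1) ^+ eps *: B.
Local Notation tor := (torus_elt B eps).
Local Notation sym_part := (sym_part B).
Variable m : nat.
Local Notation regular := (@regular K eps m).

Local Notation ca := (eps%:R : K).
Local Notation cc := (if eps then 4%:R else 1 : K).

(** The conditions defining regularity are invariant under t_i |-> t_i^-1, and
    are conditions on the t_i + t_i^-1 - 2. *)
Lemma regular_of_trace_ev (mu : 'I_m -> K) : injective mu ->
  (forall i, mu i != 0 /\ ca * mu i + cc != 0) ->
  exists2 t, regular t & forall i, trace_ev (t 0 i) = mu i.
Proof.
move=> inj_mu mu0.
have /fin_all_exists2[t t0 tE] := fun i => trace_ev_surj (mu i).
exists (\row_i t i) => [|i]; last by rewrite mxE.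
split=> [i|i|i j ij|ep i]; rewrite !mxE //.
- apply: contraNneq (mu0 i).1 => t1; rewrite -tE t1 /trace_ev invr1.
  by rewrite -[1 + 1]/(2%:R) subrr.
- split.
    by apply: contraNneq ij => tij; apply/eqP/inj_mu; rewrite -!tE tij.
  apply: contraNneq ij => tij; apply/eqP/inj_mu; rewrite -!tE.
  have -> : t j = (t i)^-1 by apply: (mulfI (t0 i)); rewrite tij mulfV.
  by rewrite /trace_ev invrK [(t i)^-1 + t i]addrC.
have [mui] := mu0 i; rewrite ep mul1r => h; apply: contraNneq h => tt.
have t1 : t i != 1.
  apply: contraNneq mui => t1; rewrite -tE t1 /trace_ev invr1.
  by rewrite -[1 + 1]/(2%:R) subrr.
by rewrite -tE (sqr_eq1_N1 tt t1) /trace_ev invrN1; apply/eqP; ring.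
Qed.

Lemma exists_regular : exists t, regular t.
Proof.
have [r [sr ur hr]] := exists_uniq_seq [:: 0; - 4%:R : K] m.
have [||t ht _] := @regular_of_trace_ev (fun i => r`_i); last by exists t.
  by move=> i j /eqP; rewrite nth_uniq ?sr // => /eqP/val_inj.
move=> i; have /hr : r`_i \in r by rewrite mem_nth ?sr.
rewrite !inE negb_or => /andP[h0 h4]; split=> //.
case: eps; first by rewrite mul1r addr_eq0.
by rewrite mul0r add0r oner_neq0.
Qed.

Lemma hankel_tor (U W : 'M[K]_(n, m)) t : hyperbolic B U W -> regular t ->
  \det (hankel ca cc m (sym_part (tor U W t))) != 0.
Proof.
move=> UW regt; have [t0 t1 ht he] := regt.
have XG := (hyperbolic_frame symB U W).1 UW.
apply: (@hankel_split _ _ _ _ _ _ (row_mx U W) (coords B (row_mx U W) (hyperbolic_gram K eps m))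
  (\row_i trace_ev (t 0 i)) two_neq0 (coordsK XG)).
- rewrite (sym_partE unitB (tor_isometry unitB symB UW t0)) (torV unitB symB UW t0).
  rewrite /torus_elt /frame_map; set X := row_mx U W; set Y := coords _ _ _.
  have -> : diag_mx (row_mx (\row_i trace_ev (t 0 i)) (\row_i trace_ev (t 0 i))) =
      (torus_block t - 1%:M) + (torus_block (tinv t) - 1%:M).
    rewrite diag_mx_row /torus_block.
    have -> : 1%:M = block_mx 1%:M 0 0 1%:M :> 'M[K]_(m + m) by exact: scalar_mx_block.
    rewrite opp_block_mx !add_block_mx !oppr0 !addr0; congr block_mx;
      apply/matrixP => i j; rewrite !mxE /trace_ev ?invrK;
      by case: (i == j); rewrite ?mulr1n ?mulr0n; ring.
  have AC (P Q : 'M[K]_n) : 1%:M + P + (1%:M + Q) - 2%:R%:M = P + Q.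
    apply/matrixP => i j; rewrite !mxE.
    by case: (i == j); rewrite ?mulr1n ?mulr0n; ring.
  rewrite AC; move: (torus_block t - 1%:M) (torus_block (tinv t) - 1%:M) => D1 D2.
  by rewrite mulmxDr mulmxDl.
- by move=> i j /=; rewrite !mxE => /(trace_ev_inj regt).
move=> i; rewrite mxE; split; first exact: trace_ev_neq0.
case ep : eps; first by rewrite mul1r trace_evN4 //; apply: he.
by rewrite mul0r add0r oner_neq0.
Qed.

Variables U0 W0 : 'M[K]_(n, m).
Hypothesis UW0 : hyperbolic B U0 W0.
Local Notation T := (std_torus B eps U0 W0).

Lemma conjugatesP h : conjugates_of_regular_part B T h <->
  exists U W t, [/\ hyperbolic B U W, regular t & h = tor U W t].
Proof.
split=> [[x [g [hx /(regular_partP two_neq0 unitB symB UW0)[t ht ->] ->]]]|].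
  exists (x *m U0), (x *m W0), t; split=> //; first exact: hyperbolic_image.
  by rewrite tor_image.
move=> [U [W [t [UW ht ->]]]].
have [x hx xE] := tor_conj two_neq0 unitB symB UW0 UW.
exists x, (tor U0 W0 t); split=> //.
by apply/(regular_partP two_neq0 unitB symB UW0); exists t.
Qed.

(** The neighbourhood of h is given by the Hankel determinant and by a minor of
    s - 1 that is nonzero at s = h. *)
Lemma conjugates_open :
  zariski_open_in (isometries_le B (m + m)) (conjugates_of_regular_part B T).
Proof.
apply: zariski_open_local => h /conjugatesP[U [W [t [UW regt hE]]]].
  have [t0 _ _ _] := regt; rewrite hE; split; first exact: (tor_isometry unitB symB UW).
  exact: rank_tor.
have [t0 t1 _ _] := regt.
have rh : \rank (h - 1%:M) = (m + m)%N by rewrite hE (rank_tor_eq symB UW).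
have [L [R LR]] := rank_minor (h - 1%:M).
exists (fun s => \det (hankel ca cc m (sym_part s)) * \det (L *m (s - 1%:M) *m R)); split.
- apply: polyfunM; apply: polyfun_det; last by polymx_tac.
  move=> i j; have hs := polymx_sym_part B.
  have hp : polyfun (fun s : 'M[K]_n =>
      \tr (sym_part s ^+ (i + j).+1 *m (ca *: sym_part s + cc%:M))) by polymx_tac.
  by apply: polyfun_ext hp => s; rewrite mxE.
- rewrite LR det1 mulr1 hE; exact: hankel_tor.
move=> s [hs rs]; rewrite mulf_eq0 negb_or => /andP[hk /minor_rank].
rewrite rh => rs'; have {rs'}rs : \rank (s - 1%:M) = (m + m)%N.
  by apply/eqP; rewrite eqn_leq rs rs'.
have [mu inj_mu mu0] := hankel_eigenvalues hk.
have [|t' regt' tE] := regular_of_trace_ev inj_mu.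
  by move=> i; have [] := mu0 i.
apply/conjugatesP.
have [|U' [W' [UW' sE]]] := recognise_torus two_neq0 unitB symB hs rs regt'.
  by move=> i; rewrite tE; have [] := mu0 i.
by exists U', W', t'.
Qed.

Lemma conjugates_nonempty : exists h, conjugates_of_regular_part B T h.
Proof.
have [t ht] := exists_regular; exists (tor U0 W0 t); apply/conjugatesP.
by exists U0, W0, t.
Qed.

End Openness.

Section Gram.
Variables (F : fieldType) (K : closedFieldType) (iota : {rmorphism F -> K}).
Variables (X : vectType F) (eps : bool) (b : {hermitian X for eps & idfun}).
Variable e : (\dim {:X}).-tuple X.

Lemma gram_sym_form : (gram_over iota e b)^T = (-1) ^+ eps *: gram_over iota e b.
Proof. by apply/matrixP => i j; rewrite !mxE hermC rmorphM rmorph_sign. Qed.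

(** A vector in the kernel of the Gram matrix gives an element of the radical. *)
Lemma gram_unit : nondegenerate b -> basis_of {:X} e -> gram_over iota e b \in unitmx.
Proof.
move=> nd be; pose G := \matrix_(i, j) b e`_i e`_j : 'M[F]_(\dim {:X}).
have -> : gram_over iota e b = map_mx iota G by apply/matrixP => i j; rewrite !mxE.
rewrite map_unitmx -row_free_unit -kermx_eq0; apply/negPn/negP => /rowV0Pn[v].
move=> /sub_kermxP vG /eqP; apply.
pose u := \sum_i v 0 i *: e`_i.
have ue (j : 'I_(\dim {:X})) : b u e`_j = 0.
  have /matrixP/(_ 0 j) := vG; rewrite !mxE => <-.
  by rewrite /u linear_sumlz; apply: eq_bigr => i _; rewrite mxE linearZl_LR.
have : u \in (orthov b fullv).
  apply/mem_orthovP => w /(coord_basis be) ->.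
  by rewrite linear_sumr big1 // => i _; rewrite linearZr_LR /= ue mulr0.
rewrite (eqP nd) memv0 => /eqP u0.
apply/rowP => i; rewrite mxE; have /freeP := basis_free be; apply.
exact: u0.
Qed.

End Gram.

Theorem proposition2
  (F : fieldType) (charF : 2%N \notin [pchar F])
  (Fbar : closedFieldType) (iota : {rmorphism F -> Fbar})
  (algFbar : forall x : Fbar, algebraicOver iota x)
  (X : vectType F) (eps : bool) (b : {hermitian X for eps & idfun})
  (nondeg_b : nondegenerate b)
  (e : (\dim {:X}).-tuple X) (basis_e : basis_of {:X} e)
  (k : nat) (even_k : ~~ odd k) (le_k : (k <= \dim {:X})%N)
  (S : 'M[Fbar]_(\dim {:X}) -> Prop)
  (maxS : maximal_torus_le iota (gram_over iota e b) k S) :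
  (exists h, conjugates_of_regular_part (gram_over iota e b) S h) /\
  zariski_open_in (isometries_le (gram_over iota e b) k)
    (conjugates_of_regular_part (gram_over iota e b) S).
Proof.
have two0 : 2%:R != 0 :> Fbar.
  rewrite -(rmorph_nat iota) fmorph_eq0; move: charF.
  by rewrite inE /=.
have unitB := gram_unit iota nondeg_b basis_e.
have symB := gram_sym_form iota b e.
have kE : k = (k./2 + k./2)%N by rewrite addnn even_halfK.
have [_ [d [torS Sle Smax]]] := maxS.
rewrite kE in le_k Sle Smax *.
have [U [W [UW SE]]] := maximal_torus_standard two0 unitB symB le_k torS Sle Smax.
have -> : S = std_torus (gram_over iota e b) eps U W.
  by apply: functional_extensionality => s; apply: propositional_extensionality.
split; first exact: (conjugates_nonempty two0 unitB symB UW).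
exact: (conjugates_open two0 unitB symB UW).
Qed.
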